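(* Let $n\ge 1$ and let $d$ be a loop-free diagram in the Temperley--Lieb diagram algebra $\mathbb{D}\mathrm{TL}(A_n)$ (i.e. a loop-free $(n+1)$-diagram). Then $d$ is indexed by the heap determined by $G_d^S$. That is, the labeled directed graph $G_d^S$ (with each directed edge $R\to R'$ read as ''$R$ covers $R'$'') is the labeled Hasse diagram of the heap $H(w)$ of a fully commutative element $w\in \mathrm{FC}(A_n)$, and this $w$ satisfies $d_w=d$.
   Context: **Coxeter group.** $W(A_n)$ is the group generated by $S=\{s_1,\dots,s_n\}$ subject to $s_i^2=e$, $s_is_j=s_js_i$ for $|i-j|>1$, and $s_is_js_i=s_js_is_j$ for $|i-j|=1$. A word $s_{x_1}\cdots s_{x_m}$ representing $w$ with $m$ minimal is a reduced expression for $w$. An element $w$ is fully commutative (FC) if any two of its reduced expressions are related by a finite sequence of commutations $s_is_j\mapsto s_js_i$ with $|i-j|>1$; $\mathrm{FC}(A_n)$ is the set of FC elements. **Heaps.** For a reduced expression $s_{x_1}\cdots s_{x_k}$, the heap is the poset on $\{1,\dots,k\}$ whose order $\prec$ is the transitive closure of: $j\prec i$ if $i<j$ and $s_{x_i},s_{x_j}$ do not commute or $s_{x_i}=s_{x_j}$; the element $i$ carries the label $s_{x_i}$. (So letters further left are higher.) For $w\in\mathrm{FC}(A_n)$ the heap, as a labeled poset up to label-preserving isomorphism, does not depend on the reduced expression and is denoted $H(w)$. **Diagrams.** The standard $k$-box is a rectangle with nodes $1,\dots,k$ (left to right) on its top (north) face and $1',\dots,k'$ on its bottom (south) face, with $i'$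 directly below $i$. A loop-free $k$-diagram is an isotopy class (isotopies fixing the boundary of the box) of families of $k$ pairwise disjoint planar curves (edges) embedded in the box such that each of the $2k$ nodes is an endpoint of exactly one edge and each edge meets the box boundary transversely, only at its endpoints, with no closed curves. $\mathbb{D}\mathrm{TL}(A_n)$ is the free $\mathbb{Z}[\delta]$-module on loop-free $(n+1)$-diagrams; the product $d'd$ is obtained by placing $d'$ on top of $d$, identifying node $i'$ of $d'$ with node $i$ of $d$, removing the identified boundary, and replacing each resulting closed loop by a factor $\delta$. The simple diagram $d_i$ ($1\le i\le n$) has an edge joining $i$ to $i+1$, an edge joining $i'$ to $(i+1)'$, and vertical edges joining $j$ to $j'$ for $j\ne i,i+1$. For $w\in\mathrm{FC}(A_n)$ with reduced expression $s_{x_1}\cdots s_{x_k}$ put $d_w=d_{x_1}\cdots d_{x_k}$ (for $w=e$, the identity diagram); this is independent of the reduced expression. It is known that $w\mapsto d_w$ is a bijection from $\mathrm{FC}(A_n)$ to the set of loop-free $(n+1)$-diagrams; ''$d$ is indexed by $w$'', or by the heap $H(w)$, means $d=d_w$. **Columns and regions.** Represent $d$ by a concrete drawing in which no edge doubles back on itself: other than vertical propagating edges (straight edges from $i$ to $i'$), no edge meets any vertical line more than once. All notions below are independent of the choice of such a drawing. The column $C_i$ ($1\le i\le n$) is the part of the box strictly between the vertical lines through nodes $i$ and $i+1$; a vertical propagating edge lies on a boundary between columns, not within a column. The regions of $C_i$ are the connected components of the complement of the edges in $C_i$. Two regions of the same column are vertically adjacent if they are adjacent across a common edge. Within each column, regions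 are labeled alternately $0,1,0,1,\dots$ from north to south, starting with $0$ for the region just below the north face; they are accordingly called $0$-regions and $1$-regions. Regions $R,R'$ of adjacent columns are horizontally adjacent if there are points $p\in R$, $p'\in R'$ such that the line segment joining $p$ and $p'$ does not cross any edge of $d$. Write $R\to R'$ if there is a region $T$ that is vertically adjacent to $R$, lies below $R$, and is horizontally adjacent to $R'$. **The graph.** $G_d$ is the directed graph whose vertices are the $1$-regions of $d$ and whose directed edges are the pairs $(R,R')$ with $R\to R'$. $G_d^S$ is $G_d$ together with the vertex labeling that assigns $s_i$ to each $1$-region lying in column $C_i$. *)

(* Defs.v *)
From Stdlib Require Import Relation_Operators.
From HB Require Import structures.
From mathcomp Require Import all_boot all_order all_algebra.
From mathcomp Require Import zify.
From mathcomp Require Import all_classical all_reals all_analysis.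

Set Implicit Arguments.
Unset Strict Implicit.
Unset Printing Implicit Defensive.

Import Order.TTheory GRing.Theory Num.Theory numFieldNormedType.Exports.

Local Open Scope quotient_scope.
Local Open Scope classical_set_scope.
Local Open Scope ring_scope.

(* Indices start at 0: the generators s_1, ..., s_n of W(A_n), and the columns
   C_1, ..., C_n, are indexed by 'I_n; the nodes 1, ..., n+1 of each face of
   the (n+1)-box are indexed by 'I_n.+1. *)

Definition word (n : nat) := seq 'I_n.

Definition far n (i j : 'I_n) : bool := (i.+1 < j)%N || (j.+1 < i)%N.
Definition neighbors n (i j : 'I_n) : bool := (i.+1 == j :> nat) || (j.+1 == i :> nat).

Inductive comm_rule n : word n -> word n -> Prop :=
| CommRule i j of far i j : comm_rule [:: i; j] [:: j; i].

Inductive cox_rule n : word n -> word n -> Prop :=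
| CoxSquare i : cox_rule [:: i; i] [::]
| CoxComm i j of far i j : cox_rule [:: i; j] [:: j; i]
| CoxBraid i j of neighbors i j : cox_rule [:: i; j; i] [:: j; i; j].

Inductive word_cong n (rule : word n -> word n -> Prop) : word n -> word n -> Prop :=
| CongRule u v a b of rule a b : word_cong rule (u ++ a ++ v) (u ++ b ++ v)
| CongRefl x : word_cong rule x x
| CongSym x y of word_cong rule x y : word_cong rule y x
| CongTrans x y z of word_cong rule x y & word_cong rule y z : word_cong rule x z.

Definition cox_rel n : rel (word n) := fun x y => `[< word_cong (@cox_rule n) x y >].

Fact cox_rel_refl n : reflexive (@cox_rel n).
Proof. by move=> x; apply/asboolP; exact: CongRefl. Qed.

Fact cox_rel_sym n : symmetric (@cox_rel n).
Proof. by move=> x y; apply/asboolP/asboolP; exact: CongSym. Qed.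

Fact cox_rel_trans n : transitive (@cox_rel n).
Proof. by move=> y x z /asboolP xy /asboolP yz; apply/asboolP; exact: CongTrans xy yz. Qed.

Canonical cox_equiv n :=
  EquivRel (@cox_rel n) (@cox_rel_refl n) (@cox_rel_sym n) (@cox_rel_trans n).

(* The generators are involutions, so the presented group is the presented
   monoid: words in the generators modulo the congruence. *)
Definition coxA n := {eq_quot (cox_equiv n)}.

Definition word_elt n (x : word n) : coxA n := \pi_(coxA n) x.

Definition commuting n (i j : 'I_n) : Prop :=
  word_elt [:: i; j] = word_elt [:: j; i].

Definition reduced_expr n (w : coxA n) (x : word n) : Prop :=
  word_elt x = w /\ forall y : word n, word_elt y = w -> (size x <= size y)%N.

Definition fully_commutative n (w : coxA n) : Prop :=
  forall x y, reduced_expr w x -> reduced_expr w y -> word_cong (@comm_rule n) x y.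

Record ldigraph (L : Type) := LDigraph {
  vertex : Type;
  arrow : vertex -> vertex -> Prop;
  vlabel : vertex -> L
}.

Definition ldigraph_iso L (G H : ldigraph L) : Prop :=
  exists f : vertex G -> vertex H,
    [/\ bijective f,
        forall u, vlabel (f u) = vlabel u
      & forall u v, arrow (f u) (f v) <-> arrow u v].

Section Heap.
Variables (n : nat) (x : word n).

Definition heap_label (i : 'I_(size x)) : 'I_n := tnth (in_tuple x) i.

(* The heap order reverses positions: letters further left are higher. *)
Definition heap_gen (j i : 'I_(size x)) : Prop :=
  (i < j)%N /\ (~ commuting (heap_label i) (heap_label j) \/ heap_label i = heap_label j).

Definition heap_lt : 'I_(size x) -> 'I_(size x) -> Prop := clos_trans _ heap_gen.

Definition heap_covers (i j : 'I_(size x)) : Prop :=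
  heap_lt j i /\ forall m, ~ (heap_lt j m /\ heap_lt m i).

Definition heap_hasse : ldigraph 'I_n :=
  {| vertex := 'I_(size x); arrow := heap_covers; vlabel := heap_label |}.

End Heap.

(* (true, i) is a node of the north face, (false, i) the node of the south face
   below it. *)
Definition node (n : nat) := (bool * 'I_n.+1)%type.

(* Rank of a node when the boundary of the box is followed clockwise from the
   leftmost node of the north face. *)
Definition bdpos n (u : node n) : nat :=
  if u.1 then (u.2 : nat) else (n.*2.+1 - u.2)%N.

Definition noncrossing n (m : {ffun node n -> node n}) : bool :=
  [forall u, forall v,
    ~~ [&& (bdpos u < bdpos v)%N, (bdpos v < bdpos (m u))%N
         & (bdpos (m u) < bdpos (m v))%N]].

Definition is_diagram n (m : {ffun node n -> node n}) : bool :=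
  [&& [forall u, m (m u) == u], [forall u, m u != u] & noncrossing m].

(* The isotopy class of a family of disjoint curves in the (n+1)-box is
   determined by which nodes are joined, so a loop-free (n+1)-diagram is a
   noncrossing perfect matching, given by the map from a node to the other end
   of its edge. *)
Record diagram n := Diagram {
  partner :> {ffun node n -> node n};
  diagramP : is_diagram partner
}.

HB.instance Definition _ n := [isSub for @partner n].
HB.instance Definition _ n := [Finite of diagram n by <:].

Definition id_partner n : {ffun node n -> node n} :=
  [ffun u : node n => (~~ u.1, u.2)].

Fact id_is_diagram n : is_diagram (id_partner n).
Proof.
apply/and3P; split.
- by apply/forallP => -[b i]; rewrite !ffunE /= negbK.
- by apply/forallP => -[b i]; rewrite !ffunE xpair_eqE; case: b.
- apply/forallP => -[b i]; apply/forallP => -[c j]; rewrite !ffunE /bdpos /=.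
  by move: (ltn_ord i) (ltn_ord j); case: b; case: c => /=; lia.
Qed.

Definition id_diagram n : diagram n := Diagram (id_is_diagram n).

Definition simple_partner n (i : 'I_n) : {ffun node n -> node n} :=
  [ffun u : node n => if (u.2 : nat) == i then (u.1, inord i.+1)
             else if (u.2 : nat) == i.+1 then (u.1, inord i)
             else (~~ u.1, u.2)].

Fact simple_is_diagram n (i : 'I_n) : is_diagram (simple_partner i).
Proof.
have hi := ltn_ord i.
have vS : (inord i.+1 : 'I_n.+1) = i.+1 :> nat by rewrite inordK // ltnS.
have v0 : (inord i : 'I_n.+1) = i :> nat by rewrite inordK // ltnS ltnW.
apply/and3P; split.
- apply/forallP => -[b j]; rewrite !ffunE /=.
  have [ji|jNi] := eqVneq (j : nat) i.
    rewrite /= vS gtn_eqF // eqxx xpair_eqE eqxx /=; apply/eqP/val_inj.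
    by rewrite /= v0.
  have [jS|jNS] := eqVneq (j : nat) i.+1.
    by rewrite /= v0 eqxx xpair_eqE eqxx /=; apply/eqP/val_inj; rewrite /= vS.
  by rewrite /= (negbTE jNi) (negbTE jNS) negbK.
- apply/forallP => -[b j]; rewrite !ffunE /=.
  have [ji|jNi] := eqVneq (j : nat) i.
    by rewrite xpair_eqE eqxx /= -val_eqE /= vS ji gtn_eqF.
  have [jS|jNS] := eqVneq (j : nat) i.+1.
    by rewrite xpair_eqE eqxx /= -val_eqE /= v0 jS ltn_eqF.
  by rewrite xpair_eqE; case: b.
- apply/forallP => -[b j]; apply/forallP => -[c k]; rewrite !ffunE /bdpos /=.
  move: (ltn_ord j) (ltn_ord k) => hj hk.
  have [ji|jNi] := eqVneq (j : nat) i;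
    [|have [jS|jNS] := eqVneq (j : nat) i.+1];
  (have [ki|kNi] := eqVneq (k : nat) i;
    [|have [kS|kNS] := eqVneq (k : nat) i.+1]);
  by case: b; case: c => /=; rewrite ?vS ?v0; lia.
Qed.

Definition simple_diagram n (i : 'I_n) : diagram n := Diagram (simple_is_diagram i).

Section Concatenation.
Variables (n : nat) (a b : diagram n).

(* Placing a on top of b gives three rows of nodes: Some true (the north face
   of a), None (the south face of a, identified with the north face of b) and
   Some false (the south face of b). *)
Definition gnode := (option bool * 'I_n.+1)%type.

Definition in_upper (u : node n) : gnode := (if u.1 then Some true else None, u.2).
Definition in_lower (u : node n) : gnode := (if u.1 then None else Some false, u.2).
Definition in_outer (u : node n) : gnode := (Some u.1, u.2).

Definition glue : rel gnode := fun p q =>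
  [exists u, (p == in_upper u) && (q == in_upper (a u))]
  || [exists u, (p == in_lower u) && (q == in_lower (b u))].

Definition is_concat (e : diagram n) : bool :=
  [forall u, forall v,
    (e u == v) == (u != v) && connect glue (in_outer u) (in_outer v)].

Definition closed_loops : nat :=
  n_comp glue [pred p | [forall u, ~~ connect glue p (in_outer u)]].

End Concatenation.

(* The free Z[delta]-module on loop-free diagrams; delta is 'X. *)
Definition DTL n := {ffun diagram n -> {poly int}}.

Definition dbasis n (d : diagram n) : DTL n := [ffun e => (e == d)%:R].

(* Bilinear extension of: the product of a and b is
   delta ^ (number of closed loops) times the concatenation of a over b. *)
Definition dmul n (f g : DTL n) : DTL n :=
  [ffun e => \sum_(a : diagram n) \sum_(b : diagram n | is_concat a b e)
               f a * g b * 'X ^+ closed_loops a b].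

Definition word_diagram n (x : word n) : DTL n :=
  foldr (fun i f => dmul (dbasis (simple_diagram i)) f) (dbasis (id_diagram n)) x.

Section Drawings.
Variable R : realType.

(* The (n+1)-box is [0, n+2] x [0, 1]. *)
Definition node_pt n (u : node n) : R * R := (u.2.+1%:R, if u.1 then 1 else 0).

Definition box_interior n (p : R * R) : Prop :=
  [/\ 0 < p.1, p.1 < n.+2%:R, 0 < p.2 & p.2 < 1].

(* A drawing of d in which no edge doubles back on itself; curve u is the edge
   at the node u, parametrized from u to its other end. Curves are only
   required to be continuous, so transversality to the boundary is replaced by
   the weaker condition that the boundary is met only at the two ends. *)
Record drawing n (d : diagram n) := Drawing {
  curve : node n -> R -> R * R;
  curve_continuous : forall u, {within `[0, 1], continuous (curve u)};
  curve_inj : forall u, {in `[0, 1] &, injective (curve u)};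
  curve_source : forall u, curve u 0 = node_pt u;
  curve_target : forall u, curve u 1 = node_pt (d u);
  curve_rev : forall (u : node n) (t : R), t \in `[0, 1] -> curve (d u) t = curve u (1 - t);
  curve_interior : forall (u : node n) (t : R), t \in `]0, 1[ -> box_interior n (curve u t);
  curve_disjoint : forall u v : node n, v != u -> v != d u ->
    {in `[0, 1] &, forall s t, curve u s <> curve v t};
  curve_no_double_back : forall u,
    {in `[0, 1], forall t, (curve u t).1 = (node_pt u).1} \/
    {in `[0, 1] &, injective (fun t => (curve u t).1)}
}.

Section Regions.
Variables (n : nat) (d : diagram n) (D : drawing d).

Definition edges : set (R * R) :=
  [set p | exists u (t : R), t \in `[0, 1] /\ curve D u t = p].

Definition column (i : 'I_n) : set (R * R) :=
  [set p | [/\ i.+1%:R < p.1, p.1 < i.+2%:R & 0 <= p.2 <= 1]].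

Definition region (i : 'I_n) (A : set (R * R)) : Prop :=
  exists2 p, (column i `\` edges) p & A = connected_component (column i `\` edges) p.

Definition vert_adjacent (i : 'I_n) (A B : set (R * R)) : Prop :=
  [/\ region i A, region i B, A <> B
    & exists p, [/\ column i p, edges p, closure A p & closure B p]].

Definition lies_below (B A : set (R * R)) : Prop :=
  forall x y z : R, B (x, y) -> A (x, z) -> y < z.

Definition segment_pt (p q : R * R) (t : R) : R * R :=
  ((1 - t) * p.1 + t * q.1, (1 - t) * p.2 + t * q.2).

Definition horiz_adjacent (i : 'I_n) (A : set (R * R)) (j : 'I_n) (B : set (R * R)) : Prop :=
  [/\ neighbors i j, region i A, region j B
    & exists p q, [/\ A p, B q & forall t : R, t \in `[0, 1] -> ~ edges (segment_pt p q t)]].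

(* The alternating labeling from north to south: true stands for the label 1
   and false for the label 0. *)
Inductive region_label (i : 'I_n) : set (R * R) -> bool -> Prop :=
| LabelNorth A of region i A & (exists x, A (x, 1)) : region_label i A false
| LabelNext A B b of region_label i A b & vert_adjacent i A B & lies_below B A :
    region_label i B (~~ b).

Definition one_region := {v : 'I_n * set (R * R) | region_label v.1 v.2 true}.

Definition region_arrow (r s : one_region) : Prop :=
  let: (i, A) := sval r in
  let: (j, B) := sval s in
  exists T, [/\ vert_adjacent i A T, lies_below T A & horiz_adjacent i T j B].

Definition region_graph : ldigraph 'I_n :=
  {| vertex := one_region; arrow := region_arrow; vlabel := fun r => (sval r).1 |}.

End Regions.
End Drawings.

(* Main.v *)
Require Import Defs.
From Stdlib Require Import Relation_Operators Operators_Properties.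
From mathcomp Require Import all_boot all_order all_fingroup all_algebra.
From mathcomp Require Import zify ring lra.
From mathcomp Require Import all_classical all_reals all_analysis.

(** In each column the region containing a point is determined by the number of
    edges above the point. Crossing the vertical line through a node changes this
    number by one, the sign depending only on whether the edge at the north node
    goes right or left. So the region graph is determined by two data: half the
    number of edges crossing each column, which is the number of its 1-regions, and
    the directions of the edges at the north nodes, which say how the 1-regions of
    adjacent columns interlace. A word "realizes" d if the numbers of occurrences
    of its letters and the interlacing of adjacent letters are given by these data;
    its heap then has the region graph as its Hasse diagram.

    A first letter s_i of a word realizing d is a cap of d between the north nodes
    of column i; joining the ends of this cap to the ends of the edge just below it
    gives a diagram d' with d_i d' = d which is realized by the rest of the word.
    By induction d_x = d for every word x realizing d. The permutation of x moves a
    node to the right or to the left according to the edge at that north node, and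
    it avoids the pattern 321; hence its descents are caps of d, its length is the
    size of x, and all its reduced words arise from x by commutations. *)

Set Implicit Arguments.
Unset Strict Implicit.
Unset Printing Implicit Defensive.

(** * Widths of the columns of a diagram *)

(** The region graph and the heap are never compared with each other directly. Each is identified
    with one model built from [d] alone: the pairs [(i, t)] with [t < height d i], with arrows given
    by the directions at the north nodes. For words, no exchange condition or normal form is used:
    inversions bound the length of a word from below, and a word with the permutation of a realizing
    word and no greater length is reached from it by commutations. For drawings, the obstacle is
    that curves are merely continuous. An edge that does not double back is the graph of a
    continuous function of the abscissa, and disjoint graphs keep their vertical order over a column
    by the intermediate value theorem. Only the north nodes matter because edges are counted from
    above: an edge ending at a south node lies below every point of the open vertical line there.
    The south face enters through a parity: all widths are even. *)

Section DiagramWidth.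
Variables (n : nat) (d : diagram n).
Implicit Types (u v : node n) (k : nat).

Definition north k : node n := (true, inord k).
Definition south k : node n := (false, inord k).

Arguments north : simpl never.
Arguments south : simpl never.

Lemma partnerK : involutive d.
Proof. by move=> u; case/and3P: (diagramP d) => /forallP/(_ u)/eqP. Qed.

Lemma partner_neq u : d u != u.
Proof. by case/and3P: (diagramP d) => _ /forallP/(_ u). Qed.

Lemma partner_noncrossing u v :
  ~~ [&& bdpos u < bdpos v, bdpos v < bdpos (d u) & bdpos (d u) < bdpos (d v)].
Proof. by case/and3P: (diagramP d) => _ _ /forallP/(_ u)/forallP/(_ v). Qed.

Lemma bdpos_inj : injective (@bdpos n).
Proof.
move=> [b i] [c j]; rewrite /bdpos /=; have := ltn_ord i; have := ltn_ord j.
case: b c => -[] hj hi e; (do 2?congr (_, _)); try (apply: val_inj => /=); lia.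
Qed.

(* An edge is represented by its left end: crosses k u says that the edge at u
   goes from the left of column k at u to the right of column k. *)
Definition crosses k u := (u.2 <= k) && (k < (d u).2).
Definition width k := \sum_(u : node n) crosses k u.
Definition goes_right u := u.2 < (d u).2.
Definition goes_left u := (d u).2 < u.2.

Lemma goes_left_partner u : goes_left u = goes_right (d u).
Proof. by rewrite /goes_right partnerK. Qed.

Lemma node_at u k : u.2 = k :> nat -> u = north k \/ u = south k.
Proof.
by case: u => -[] i /= ik; [left|right]; congr (_, _); apply: val_inj;
  rewrite /= inordK -ik.
Qed.

Lemma north2 k : k <= n -> (north k).2 = k :> nat.
Proof. by move=> kn; rewrite /north /= inordK. Qed.

Lemma south2 k : k <= n -> (south k).2 = k :> nat.
Proof. by move=> kn; rewrite /south /= inordK. Qed.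

Lemma bdpos_north k : k <= n -> bdpos (north k) = k.
Proof. by move=> kn; rewrite /bdpos /= inordK. Qed.

Lemma bdpos_south k : k <= n -> bdpos (south k) = n.*2.+1 - k.
Proof. by move=> kn; rewrite /bdpos /= inordK. Qed.

Lemma bdposE u : bdpos u = if u.1 then u.2 : nat else n.*2.+1 - u.2.
Proof. by []. Qed.

Lemma sum_node_at k (F : node n -> bool) : k <= n ->
  \sum_(u : node n) ((u.2 == k :> nat) && F u : nat) = F (north k) + F (south k).
Proof.
have SN : south k != north k by rewrite xpair_eqE.
move=> kn; rewrite (bigD1 (north k)) // (bigD1 (south k)) // big1.
  by rewrite north2 // ?south2 // eqxx /= addn0.
move=> u; rewrite andTb => /andP[uN uS]; case: eqP => // uk.
by case: (node_at uk) => e; rewrite e eqxx in uN uS.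
Qed.

(** Columns [k] and [k.+1] are crossed by the same edges, except those with an end at abscissa
    [k.+1]. Reindexing by [d] lets each edge be counted at its left end on both sides. *)
Lemma width_step k : k < n ->
  width k.+1 + goes_left (north k.+1) + goes_left (south k.+1)
  = width k + goes_right (north k.+1) + goes_right (south k.+1).
Proof.
move=> kn; rewrite -!addnA -!sum_node_at //.
rewrite [X in _ + X = _](reindex_inj (inv_inj partnerK)) -!big_split /=.
apply: eq_bigr => u _; rewrite /crosses /goes_right /goes_left partnerK.
by lia.
Qed.

Lemma width0 : width 0 = goes_right (north 0) + goes_right (south 0).
Proof.
rewrite -sum_node_at //; apply: eq_bigr => u _; rewrite /crosses /goes_right.
by lia.
Qed.

Lemma width_ge k : n <= k -> width k = 0.
Proof.
move=> nk; apply: big1 => u _; rewrite /crosses; have := ltn_ord (d u).2.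
by lia.
Qed.

Lemma width_gt0 k u : crosses k u -> 0 < width k.
Proof. by move=> ku; rewrite /width (bigD1 u) //= ku. Qed.

Lemma same_column u : (d u).2 = u.2 :> nat -> d u = (~~ u.1, u.2).
Proof.
case: u (partner_neq u) => b i /=; case: (d _) => c j /= ne ji; move: ne.
by rewrite (val_inj ji) xpair_eqE eqxx andbT => ne; congr (_, _); case: b c ne => -[].
Qed.

Lemma partner_north k : k <= n ->
  (d (north k) == south k) = ~~ goes_right (north k) && ~~ goes_left (north k).
Proof.
move=> kn; rewrite /goes_right /goes_left; apply/eqP/idP => [->|].
  by rewrite south2 // ?north2 // ltnn.
by rewrite -!leqNgt -eqn_leq => /eqP/same_column ->.
Qed.

Lemma partner_south k : k <= n ->
  (d (north k) == south k) = ~~ goes_right (south k) && ~~ goes_left (south k).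
Proof.
move=> kn; rewrite /goes_right /goes_left (can2_eq partnerK partnerK) eq_sym.
apply/eqP/idP => [->|]; first by rewrite south2 // ?north2 // ltnn.
by rewrite -!leqNgt -eqn_leq => /eqP/same_column ->.
Qed.

Lemma goes_right_left u : goes_right u -> ~~ goes_left u.
Proof. by rewrite /goes_right /goes_left -leqNgt => /ltnW. Qed.

(** The two nodes at a given abscissa are either joined to each other or both joined sideways. So
    the numbers of edges going right and left there have the same parity, and each step changes the
    width by an even number. *)
Lemma width_even k : k <= n -> ~~ odd (width k).
Proof.
have parity j : j <= n -> odd (goes_right (north j) + goes_right (south j)) =
    odd (goes_left (north j) + goes_left (south j)).
  move=> jn; have := partner_north jn; rewrite partner_south //.
  have := @goes_right_left (north j); have := @goes_right_left (south j).
  by do 4!case: (_ (_ j)) => //; move=> //= h1 h2; try case: (h1 isT); try case: (h2 isT).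
have left0 u : u.2 = 0 :> nat -> goes_left u = false by rewrite /goes_left => ->.
elim: k => [_|k IHk kn].
  by rewrite width0 parity // !left0 // ?north2 // south2.
have := width_step kn; have := parity _ kn; have := IHk (ltnW kn); lia.
Qed.

(** A vertical edge cuts the box in two, and no edge can pass from one side to the other. *)
Lemma partner_vertical_width k : k <= n -> d (north k) = south k ->
  width k = 0 /\ width k.-1 = 0.
Proof.
move=> kn e; have noncross u : u.2 < k -> k < (d u).2 -> False.
  move=> uk ku; have := partner_noncrossing u (north k).
  have := partner_noncrossing (north k) (d u); rewrite partnerK e.
  rewrite bdpos_north // bdpos_south // !bdposE.
  have := ltn_ord u.2; have := ltn_ord (d u).2.
  by case: ifP; case: ifP; lia.
have e' : d (south k) = north k by rewrite -e partnerK.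
have strict u : u.2 = k :> nat -> (d u).2 = k :> nat.
  by case/node_at => ->; rewrite ?e ?e' ?north2 ?south2.
split; apply: big1 => u _; rewrite /crosses; case: andP => // -[h1 h2]; exfalso.
  have := strict u; have := noncross u; lia.
have := strict u; have := strict (d u); rewrite partnerK; have := noncross u; lia.
Qed.

Definition height k := (width k)./2.

End DiagramWidth.

(** * Removing a simple diagram from the top of a diagram *)

Section Concat.
Variables (n : nat).
Local Notation glue := Defs.glue.
Implicit Types (a b d e : diagram n) (u v : node n).

Lemma glue_sym a b : symmetric (glue a b).
Proof.
move=> p q; rewrite /glue; congr (_ || _); apply/existsP/existsP => -[u /andP[/eqP-> /eqP->]].
- by exists (a u); rewrite partnerK !eqxx.
- by exists (a u); rewrite partnerK !eqxx.
- by exists (b u); rewrite partnerK !eqxx.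
- by exists (b u); rewrite partnerK !eqxx.
Qed.

Lemma connect_glue_sym a b : connect_sym (glue a b).
Proof. exact/sym_connect_sym/glue_sym. Qed.

Lemma glue_upper a b u : connect (glue a b) (in_upper u) (in_upper (a u)).
Proof. by apply/connect1/orP; left; apply/existsP; exists u; rewrite !eqxx. Qed.

Lemma glue_lower a b u : connect (glue a b) (in_lower u) (in_lower (b u)).
Proof. by apply/connect1/orP; right; apply/existsP; exists u; rewrite !eqxx. Qed.

Lemma connect_invariant (T : finType) (S : Type) (r : rel T) (f : T -> S) :
  (forall x y, r x y -> f x = f y) -> forall x y, connect r x y -> f x = f y.
Proof.
move=> rf x y /connectP[p]; elim: p x => [|z p IHp] x /=; first by move=> _ ->.
by case/andP=> /rf -> /IHp.
Qed.

Lemma dmul_dbasis a b d : is_concat a b d -> closed_loops a b = 0 ->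
  dmul (dbasis a) (dbasis b) = dbasis d.
Proof.
move=> abd loop0; apply/ffunP => e; rewrite !ffunE (bigD1 a) //=.
rewrite [X in (_ + X)%R]big1 ?GRing.addr0; last first.
  by move=> c ca; apply: big1 => f _; rewrite !ffunE (negbTE ca) !GRing.mul0r.
have only_b (P : pred (diagram n)) : (\sum_(f : diagram n | P f)
    dbasis a a * dbasis b f * 'X ^+ closed_loops a f = (P b)%:R :> {poly int})%R.
  case Pb: (P b); last first.
    apply: big1 => f Pf; have fb : f != b by apply: contraTneq Pf => ->; rewrite Pb.
    by rewrite !ffunE (negbTE fb) GRing.mulr0 GRing.mul0r.
  rewrite (bigD1 b) //= big1 ?GRing.addr0; last first.
    by move=> f /andP[_ fb]; rewrite !ffunE (negbTE fb) GRing.mulr0 GRing.mul0r.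
  by rewrite !ffunE !eqxx loop0 GRing.expr0 !GRing.mulr1.
rewrite only_b; congr (_%:R)%R; congr nat_of_bool.
apply/idP/eqP => [abe|-> //]; apply/val_inj/ffunP => u /=.
have /forallP/(_ u)/forallP/(_ (d u)) := abd.
have /forallP/(_ u)/forallP/(_ (d u)) := abe.
by rewrite eqxx => /eqP <- /eqP/esym/eqP.
Qed.
End Concat.

(** * Rejoining a cap and the edge below it *)

Section Surgery.
Variables (n : nat) (d : diagram n) (i : 'I_n).
Hypothesis cap : d (north n i) = north n i.+1.

Let N := north n i.
Let M := north n i.+1.

(** The width of column [i] is even, so the cap is not the only edge crossing it. Disjoint edges
    cross a column from north to south in the order of [bdpos] of their right ends, so the least
    [bdpos] selects the edge just below the cap. *)
Lemma cap_second_edge : exists b, [/\ (d b).2 <= i, i < b.2, d b != N &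
  forall v, (d v).2 <= i -> i < v.2 -> d v != N -> bdpos b <= bdpos v].
Proof.
have hi := ltn_ord i.
pose P v := [&& (d v).2 <= i, i < v.2 & d v != N].
case: (pickP P) => [v0 Pv0|P0].
  case: (arg_minnP (@bdpos n) Pv0) => b /and3P[b1 b2 b3] bmin.
  by exists b; split=> // v v1 v2 v3; apply: bmin; rewrite /P v1 v2.
have := width_even d (ltnW hi).
rewrite /width (bigD1 N) //= big1 => [|u uN].
  by rewrite /crosses cap !north2 ?leqnn // ltnW.
have := P0 (d u); rewrite /P partnerK uN andbT => h.
by rewrite /crosses h.
Qed.

Variable b : node n.
Hypotheses (b_left : (d b).2 <= i) (b_right : i < b.2) (b_N : d b != N).
Hypothesis b_min : forall v, (d v).2 <= i -> i < v.2 -> d v != N -> bdpos b <= bdpos v.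
Let a : node n := d b.

(* The edge from a to b is the second one from the north in column i, just below
   the cap from N to M. Multiplying by the simple diagram s_i from above closes N
   and M by a cap and joins a to b again. *)
Definition uncap_partner : {ffun node n -> node n} :=
  [ffun u : node n => if u == N then a else if u == a then N else
           if u == M then b else if u == b then M else d u].

Let N2 : N.2 = i :> nat. Proof. by rewrite north2 // ltnW. Qed.
Let M2 : M.2 = i.+1 :> nat. Proof. by rewrite north2. Qed.

Let distinct : [/\ [/\ N != a, N != M & N != b], a != M, a != b & M != b].
Proof.
split; first split; rewrite /a.
- by rewrite eq_sym.
- by apply/eqP => e; have := N2; rewrite e M2; lia.
- by apply/eqP => e; have := N2; rewrite e; lia.
- by apply/eqP => e; have := M2; rewrite -e; lia.
- exact: partner_neq.
- apply/eqP => e; move: b_N; rewrite -e /M -cap partnerK; by rewrite eqxx.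
Qed.

Let cap' : d M = N. Proof. by rewrite /M -cap partnerK. Qed.

Lemma uncapN : uncap_partner N = a. Proof. by rewrite ffunE eqxx. Qed.
Lemma uncapA : uncap_partner a = N.
Proof. by case: distinct => -[h _ _] *; rewrite ffunE eq_sym (negbTE h) eqxx. Qed.
Lemma uncapM : uncap_partner M = b.
Proof.
case: distinct => -[h1 h2 h3] h4 *.
by rewrite ffunE eq_sym (negbTE h2) eq_sym (negbTE h4) eqxx.
Qed.
Lemma uncapB : uncap_partner b = M.
Proof.
case: distinct => -[h1 h2 h3] h4 h5 h6; rewrite ffunE.
by rewrite eq_sym (negbTE h3) eq_sym (negbTE h5) eq_sym (negbTE h6) eqxx.
Qed.

Lemma uncap_other u : u \notin [:: N; a; M; b] ->
  uncap_partner u = d u /\ d u \notin [:: N; a; M; b].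
Proof.
rewrite !inE !negb_or => /and4P[h1 h2 h3 h4]; split.
  by rewrite ffunE (negbTE h1) (negbTE h2) (negbTE h3) (negbTE h4).
rewrite !(can2_eq (partnerK d) (partnerK d)) cap' cap /a partnerK.
by rewrite h1 h2 h3 h4.
Qed.

Lemma uncap_cases (P : node n -> Prop) :
  P N -> P a -> P M -> P b ->
  (forall u, u \notin [:: N; a; M; b] -> P u) -> forall u, P u.
Proof.
move=> pN pa pM pb po u; case: (boolP (u \in [:: N; a; M; b])) => [|/po //].
by rewrite !inE => /or4P[] /eqP ->.
Qed.

Let PN : bdpos N = i. Proof. by rewrite bdpos_north // ltnW. Qed.
Let PM : bdpos M = i.+1. Proof. by rewrite bdpos_north. Qed.

Let left_bdpos (u : node n) : (u.2 <= i) = (bdpos u <= i) || (n.*2.+1 - i <= bdpos u).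
Proof. by rewrite bdposE; have := ltn_ord u.2; have := ltn_ord i; case: ifP => _; lia. Qed.

Let bdpos_other u : u \notin [:: N; a; M; b] ->
  [/\ bdpos u <> i, bdpos u <> i.+1, bdpos u <> bdpos a & bdpos u <> bdpos b].
Proof.
rewrite !inE !negb_or => /and4P[h1 h2 h3 h4].
by split; rewrite -?PM -?PN => /bdpos_inj/eqP; apply/negP.
Qed.

(** Since [N] and [M] are consecutive on the boundary, an old edge that crosses a new one without
    crossing the edge from [a] to [b] would have to cross column [i] between the cap and that edge,
    against the minimality of [b]. All conditions are expressed by [bdpos], so the pairs of cases
    are linear arithmetic. *)
Lemma uncap_is_diagram : is_diagram uncap_partner.
Proof.
have [[Na NM Nb] aM ab Mb] := distinct.
apply/and3P; split.
- apply/forallP; apply: uncap_cases.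
  + by rewrite uncapN uncapA.
  + by rewrite uncapA uncapN.
  + by rewrite uncapM uncapB.
  + by rewrite uncapB uncapM.
  by move=> u /uncap_other[-> /uncap_other[-> _]]; rewrite partnerK.
- apply/forallP; apply: uncap_cases.
  + by rewrite uncapN eq_sym.
  + by rewrite uncapA.
  + by rewrite uncapM eq_sym.
  + by rewrite uncapB.
  by move=> u /uncap_other[-> _]; apply: partner_neq.
have hi := ltn_ord i.
have range (u : node n) : bdpos u <= n.*2.+1.
  by rewrite bdposE; have := ltn_ord u.2; move: (ltn_ord i); case: ifP => _; lia.
have Pab : bdpos a <> bdpos b by move/bdpos_inj/eqP; apply/negP.
have Pneq (u v : node n) : u != v -> bdpos u <> bdpos v by move=> + /bdpos_inj e; rewrite e eqxx.
have PMb := Pneq _ _ Mb; have PNa := Pneq _ _ Na; rewrite PM PN in PMb PNa.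
have La := left_bdpos a; rewrite b_left in La.
have Lb := left_bdpos b; rewrite leqNgt b_right in Lb.
have da : d a = b by rewrite /a partnerK.
have facts u : u \notin [:: N; a; M; b] ->
  [/\ bdpos u <> i /\ bdpos u <> i.+1, bdpos u <> bdpos a, bdpos u <> bdpos b,
     (bdpos (d u) <= i) || (n.*2.+1 - i <= bdpos (d u)) ->
     ~~ ((bdpos u <= i) || (n.*2.+1 - i <= bdpos u)) -> bdpos b <= bdpos u &
     [/\ ~~ [&& bdpos u < bdpos a, bdpos a < bdpos (d u) & bdpos (d u) < bdpos b],
        ~~ [&& bdpos u < bdpos b, bdpos b < bdpos (d u) & bdpos (d u) < bdpos a],
        ~~ [&& bdpos a < bdpos u, bdpos u < bdpos b & bdpos b < bdpos (d u)] &
        ~~ [&& bdpos b < bdpos u, bdpos u < bdpos a & bdpos a < bdpos (d u)]]].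
  move=> uo; have [p1 p2 p3 p4] := bdpos_other uo.
  have [_ duo] := uncap_other uo; have [q1 q2 q3 q4] := bdpos_other duo.
  split=> //.
    rewrite -!left_bdpos -ltnNge => h1 h2; apply: b_min => //.
    by move: duo; rewrite !inE !negb_or => /and4P[].
  split; [have := partner_noncrossing d u a | have := partner_noncrossing d u b
    | have := partner_noncrossing d a u | have := partner_noncrossing d b u];
  by rewrite ?da.
apply/forallP; apply: uncap_cases; [| | | |move=> u uo];
  (apply/forallP; apply: uncap_cases; [| | | |move=> v vo]);
  rewrite ?uncapN ?uncapA ?uncapM ?uncapB ?(uncap_other uo).1 ?(uncap_other vo).1.
all: try exact: partner_noncrossing.
all: rewrite ?PN ?PM.
all: try (move: (facts _ uo) (facts _ (uncap_other uo).2); rewrite partnerK).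
all: try (move: (facts _ vo) (facts _ (uncap_other vo).2); rewrite partnerK).
all: clear b_min facts; repeat (let h := fresh in intro h; try (case: h => -[? ?] ? ? ? [? ? ? ?])).
all: lia.
Qed.


Definition uncap : diagram n := Diagram uncap_is_diagram.

(** Outside column [i], the edges from [N] to [a] and from [M] to [b] together cross exactly the
    columns crossed by the edge from [a] to [b]. Column [i] loses this edge and the cap. *)
Lemma uncap_width k : width d k = width uncap k + (k == i).*2.
Proof.
have [[Na NM Nb] aM ab Mb] := distinct.
have uniq4 : uniq [:: N; a; M; b].
  by rewrite /= !inE !negb_or Na NM Nb aM ab Mb.
rewrite /width (bigID (mem [:: N; a; M; b])) [in RHS](bigID (mem [:: N; a; M; b])) /=.
rewrite -!big_uniq // !big_cons !big_nil /crosses /= uncapN uncapA uncapM uncapB.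
rewrite cap cap' N2 M2 {2}/a partnerK.
set x := (X in _ + X = _); set y := (X in _ = _ + X + _).
have -> : x = y by apply: eq_bigr => u /uncap_other[-> _].
have := b_left; have := b_right; rewrite -/a; lia.
Qed.

Lemma uncap_other_direction u : u != N -> u != M -> u.2 <> i :> nat -> u.2 <> i.+1 :> nat ->
  goes_right uncap u = goes_right d u /\ goes_left uncap u = goes_left d u.
Proof.
move=> uN uM; rewrite /goes_right /goes_left /= .
have := b_left; have := b_right; rewrite -/a => h1 h2.
have da : d a = b by rewrite /a partnerK.
have [->|ua] := eqVneq u a; first by rewrite uncapA N2 da; lia.
have [->|ub] := eqVneq u b; first by rewrite uncapB M2 -/a; lia.
by have [|-> _] := @uncap_other u; rewrite // !inE !negb_or uN ua uM ub.
Qed.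

Lemma uncap_cap_direction : ~~ goes_right uncap N /\ ~~ goes_left uncap M.
Proof.
by rewrite /goes_right /goes_left /= uncapN uncapM N2 M2 -!leqNgt; split.
Qed.

(* Identifies the edge of d at u; composed with rep below, it is constant on the
   connected components of the glued diagram. *)
Let edge_key (u : node n) := minn (bdpos u) (bdpos (d u)).

Let edge_key_eq u v : edge_key u = edge_key v -> u = v \/ d u = v.
Proof.
rewrite /edge_key => e.
have [/bdpos_inj|[/bdpos_inj|[/bdpos_inj|/bdpos_inj]]] :
  bdpos u = bdpos v \/ bdpos (d u) = bdpos v \/
  bdpos u = bdpos (d v) \/ bdpos (d u) = bdpos (d v) by lia.
- by left.
- by right.
- by move=> ->; right; rewrite partnerK.
- by move/(inv_inj (partnerK d)); left.
Qed.

Let edge_keyK u : edge_key (d u) = edge_key u.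
Proof. by rewrite /edge_key partnerK minnC. Qed.

(** In the glued diagram the strand from [a] to [b] runs through the middle copies of [N] and [M],
    so both are represented by [b]. Any other middle node lies below a vertical edge of [s], which
    carries it to the north face. *)
Let lower_rep (u : node n) := if (u == N) || (u == M) then b else u.

Let rep (p : gnode n) := if p.1 is Some c then (c, p.2) else lower_rep (true, p.2).

Let rep_lower u : rep (in_lower u) = lower_rep u.
Proof.
by case: u => -[] j.
Qed.

Let s := simple_diagram i.

Let simple_other (u : node n) : u.2 <> i :> nat -> u.2 <> i.+1 :> nat -> s u = (~~ u.1, u.2).
Proof. by move=> /eqP h1 /eqP h2; rewrite ffunE (negbTE h1) (negbTE h2). Qed.

Let simple_north : s N = M.
Proof. by rewrite ffunE N2 eqxx. Qed.

Let simple_south : s (south n i) = south n i.+1.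
Proof. by rewrite ffunE south2 ?eqxx // ltnW. Qed.

Let glue_key p q : Defs.glue s uncap p q -> edge_key (rep p) = edge_key (rep q).
Proof.
have [[Na NM Nb] aM ab Mb] := distinct.
have hi := ltn_ord i.
have upperN : rep (in_upper N) = N by [].
have upperM : rep (in_upper M) = M by [].
have lowN : rep (in_upper (south n i)) = b by rewrite /rep /= /lower_rep eqxx.
have lowM : rep (in_upper (south n i.+1)) = b by rewrite /rep /= /lower_rep eqxx orbT.
case/orP => /existsP[u /andP[/eqP-> /eqP->]].
  have [/node_at[]->|ui] := u.2 =P i :> nat.
  - by rewrite simple_north upperN upperM -[M]cap edge_keyK.
  - by rewrite simple_south lowN lowM.
  have [/node_at[]->|uSi] := u.2 =P i.+1 :> nat.
  - by rewrite -/M -simple_north partnerK upperN simple_north upperM -[M]cap edge_keyK.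
  - by rewrite -simple_south partnerK simple_south lowN lowM.
  rewrite simple_other //; case: u ui uSi => -[] j /= ji jSi;
  rewrite /rep /in_upper /= /lower_rep !ifF //;
    apply/negbTE; rewrite negb_or; apply/andP; split; apply/eqP;
    move=> /(congr1 (fun v : node n => v.2 : nat)); rewrite ?N2 ?M2 => e; by [apply: ji|apply: jSi].
rewrite !rep_lower; move: u; apply: uncap_cases => [||||u uo] /=.
- by rewrite uncapN /lower_rep eqxx /= -edge_keyK ifF // eq_sym (negbTE Na) (negbTE aM).
- by rewrite uncapA /lower_rep eqxx /= ifF ?edge_keyK // eq_sym (negbTE Na) (negbTE aM).
- rewrite uncapM /lower_rep eqxx orbT ifF // eq_sym (negbTE Nb) /=.
  by rewrite eq_sym (negbTE Mb).
- rewrite uncapB /lower_rep eqxx orbT ifF // eq_sym (negbTE Nb) /=.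
  by rewrite eq_sym (negbTE Mb).
have [-> duo] := uncap_other uo; rewrite /lower_rep !ifF ?edge_keyK //.
  by apply: contraNF duo; rewrite !inE => /orP[]->; rewrite ?orbT.
by apply: contraNF uo; rewrite !inE => /orP[]->; rewrite ?orbT.
Qed.

Let connected (p q : gnode n) := connect (Defs.glue s uncap) p q.

Let connectedC p q : connected p q -> connected q p.
Proof. by rewrite /connected connect_glue_sym. Qed.

Let connected_lower u : connected (in_lower u) (in_lower (uncap u)).
Proof. exact: glue_lower. Qed.

Let connected_cup : connected (in_lower N) (in_lower M).
Proof. by have := glue_upper s uncap (south n i); rewrite simple_south. Qed.

Let connected_outer u : u != N -> u != M -> connected (in_outer u) (in_lower u).
Proof.
move=> uN uM; case: u uN uM => -[] j jN jM; last exact: connect0.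
have := glue_upper s uncap (true, j); rewrite simple_other //= => e.
  by move/eqP: jN; apply; congr (_, _); apply: val_inj; rewrite /= -e inord_val.
by move/eqP: jM; apply; congr (_, _); apply: val_inj; rewrite /= -e inord_val.
Qed.

Let connected_partner u : connected (in_outer u) (in_outer (d u)).
Proof.
have [[Na NM Nb] aM ab Mb] := distinct.
have cNM : connected (in_outer N) (in_outer M).
  by have := glue_upper s uncap N; rewrite simple_north.
have oa : connected (in_outer a) (in_lower a) by apply: connected_outer; rewrite // eq_sym.
have ob : connected (in_outer b) (in_lower b) by apply: connected_outer; rewrite // eq_sym.
have cab : connected (in_outer a) (in_outer b).
  apply: (connect_trans oa).
  have := connected_lower a; rewrite /= uncapA => h; apply: (connect_trans h) => {h}.
  apply: (connect_trans connected_cup).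
  have := connected_lower M; rewrite /= uncapM => h; apply: (connect_trans h) => {h}.
  exact: connectedC.
move: u; apply: uncap_cases => [||||u uo].
- by rewrite cap.
- by rewrite /a partnerK.
- by rewrite cap'; apply: connectedC.
- exact: connectedC.
have [e duo] := uncap_other uo.
move: (uo) (duo); rewrite !inE !negb_or => /and4P[uN _ uM _] /and4P[duN _ duM _].
apply: (connect_trans (connected_outer uN uM)).
have := connected_lower u; rewrite /= e => h; apply: (connect_trans h).
exact/connectedC/connected_outer.
Qed.

Lemma simple_mul_uncap : dmul (dbasis (simple_diagram i)) (dbasis uncap) = dbasis d.
Proof.
apply: dmul_dbasis.
  apply/forallP => u; apply/forallP => v; apply/eqP; apply/eqP/andP => [<-|[uv c]].
    by rewrite eq_sym partner_neq; split=> //; apply: connected_partner.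
  have := connect_invariant glue_key c.
  rewrite /rep /= -!surjective_pairing => /edge_key_eq[] // e.
  by rewrite e eqxx in uv.
have [[Na NM Nb] aM ab Mb] := distinct.
(* No loop is closed: the middle copies of [N] and [M] are connected to [a], and every other middle
   node to the north node above it. *)
apply: eq_card0 => p; rewrite !inE; apply/negbTE; rewrite negb_and; apply/orP; right.
apply/negP => /forallP no_outer.
have outer u : connected p (in_outer u) -> False by apply/negP; exact: no_outer.
have oa : connected (in_lower a) (in_outer a).
  by apply: connectedC; apply: connected_outer; rewrite // eq_sym.
have lowN : connected (in_lower N) (in_lower a).
  by have := connected_lower N; rewrite /= uncapN.
case: p outer {no_outer} => -[c|] j outer.
  exact: (outer (c, j) (connect0 _ _)).
have [jN|jN] := eqVneq (true, j) N.
  apply: (outer a); rewrite (_ : (None, j) = in_lower N) -?jN //.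
  by rewrite jN; apply: (connect_trans lowN).
have [jM|jM] := eqVneq (true, j) M.
  apply: (outer a); rewrite (_ : (None, j) = in_lower M) -?jM //.
  rewrite jM; apply: (connect_trans (connectedC connected_cup)).
  exact: (connect_trans lowN).
by apply: (outer (true, j)); apply/connectedC/connected_outer.
Qed.

End Surgery.

(** The effect of the surgery on the two data that determine a region graph, widths and north
    directions. The choice of the second edge is forgotten. *)
Definition uncapped n (d : diagram n) (i : 'I_n) (d' : diagram n) : Prop :=
  [/\ d (north n i) = north n i.+1,
    forall k, width d k = width d' k + (k == i).*2,
    forall k, k <= n -> k <> i -> k <> i.+1 ->
      goes_right d' (north n k) = goes_right d (north n k) /\
      goes_left d' (north n k) = goes_left d (north n k),
    ~~ goes_right d' (north n i) & ~~ goes_left d' (north n i.+1)].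

Lemma uncapped_exists n (d : diagram n) (i : 'I_n) : d (north n i) = north n i.+1 ->
  exists2 d', uncapped d i d' &
    dmul (dbasis (simple_diagram i)) (dbasis d') = dbasis d.
Proof.
move=> cap; have [b [b1 b2 b3 b4]] := cap_second_edge cap.
exists (uncap cap b1 b2 b3 b4); last exact: simple_mul_uncap.
have [r l] := uncap_cap_direction cap b1 b2 b3 b4.
split=> //; first exact: uncap_width.
move=> k kn ki kSi; have kk := north2 kn.
have hi := ltn_ord i.
apply: uncap_other_direction; rewrite ?kk //; apply/eqP => e.
  by apply: ki; rewrite -kk e north2 // ltnW.
by apply: kSi; rewrite -kk e north2.
Qed.

(** * Words realizing a diagram *)

Section Height.
Variables (n : nat) (d : diagram n).
Implicit Types (k : nat).

Lemma height_width k : width d k = (height d k).*2.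
Proof.
rewrite /height; case: (leqP k n) => [/(width_even d)|/ltnW/(width_ge d) -> //].
by move=> h; rewrite -[LHS]odd_double_half (negbTE h).
Qed.

Lemma vertical_height k : k <= n ->
  ~~ goes_right d (north n k) -> ~~ goes_left d (north n k) ->
  height d k = 0 /\ height d k.-1 = 0.
Proof.
move=> kn r l; have := partner_north d kn; rewrite r l => /eqP e.
by have [h1 h2] := partner_vertical_width kn e; rewrite /height h1 h2.
Qed.

(** The north edge adds one to the width and the south edge changes it by at most one, so by
    evenness the width grows by 0 or 2. *)
Lemma height_step_right k : k < n -> goes_right d (north n k.+1) ->
  height d k <= height d k.+1 <= (height d k).+1.
Proof.
move=> kn r; have := width_step d kn; rewrite !height_width r.
by have := goes_right_left r; do 3!case: (_ d _); lia.
Qed.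

Lemma height_step_left k : k < n -> ~~ goes_right d (north n k.+1) ->
  height d k.+1 <= height d k <= (height d k.+1).+1.
Proof.
move=> kn r; case: (boolP (goes_left d (north n k.+1))) => l.
  have := width_step d kn; rewrite !height_width (negbTE r) l.
  by do 2!case: (_ d _); lia.
by have [-> ->] := vertical_height kn r l.
Qed.

Lemma height0_le1 : height d 0 <= 1.
Proof. by have := width0 d; rewrite height_width; do 2!case: (_ d _); lia. Qed.

(** The positive height excludes a vertical edge at [k.+1], so the edges at two adjacent north nodes
    go towards each other. They would cross if they were different. *)
Lemma cap_of_directions k : k < n -> 0 < height d k ->
  goes_right d (north n k) -> ~~ goes_right d (north n k.+1) ->
  d (north n k) = north n k.+1.
Proof.
move=> kn h0 r r'; have kn' := ltnW kn.
have l : goes_left d (north n k.+1).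
  by apply: contraLR h0 => l; have [_ /= ->] := vertical_height kn r' l.
apply/eqP/negPn/negP => ne; move: r l; rewrite /goes_right /goes_left !north2 //.
move=> r l; have := partner_noncrossing d (north n k) (north n k.+1).
have := partner_noncrossing d (d (north n k.+1)) (north n k); rewrite partnerK.
have p1 : bdpos (d (north n k)) <> k.+1.
  by rewrite -(bdpos_north kn) => /bdpos_inj/eqP; apply/negP.
have p2 : bdpos (d (north n k.+1)) <> k.
  rewrite -{2}(bdpos_north kn') => /bdpos_inj/(congr1 d); rewrite partnerK => e.
  by rewrite e eqxx in ne.
move: p1 p2; rewrite !bdpos_north // !bdposE.
by have := ltn_ord (d (north n k)).2; case: ifP => _; case: ifP => _; lia.
Qed.

End Height.

Section Realization.
Variable n : nat.
Implicit Types (d : diagram n) (x u v : word n) (i j : 'I_n).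

(* The letters i and j = i+1 alternate in x, starting with j exactly when the
   north node between the two columns is joined to a node on its right. *)
Definition realizes d x : Prop :=
  (forall i, count_mem i x = height d i) /\
  (forall i j u v, i.+1 = j :> nat -> x = u ++ v ->
    if goes_right d (north n j) then count_mem i u <= count_mem j u <= (count_mem i u).+1
    else count_mem j u <= count_mem i u <= (count_mem j u).+1).

(** The prefix [[:: i]] contains [i] but neither neighbour of [i], so the alternation fixes the
    directions at both nodes of column [i]. At the borders of the box, where a neighbour is missing,
    the direction is forced by the box. *)
Lemma realizes_cap d i x : realizes d (i :: x) -> d (north n i) = north n i.+1.
Proof.
move=> [cnt alt]; have hi := ltn_ord i.
have h0 : 0 < height d i by rewrite -cnt /= eqxx.
apply: cap_of_directions => //.
  apply/negPn/negP => r; case: (posnP i) => [i0|i_gt0].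
    have [_ h] : height d i = 0 /\ height d i.-1 = 0.
      by apply: (vertical_height (ltnW hi)) => //; rewrite /goes_left north2 ?i0.
    by move: h0; rewrite i0 in h *; rewrite h.
  have ip : i.-1 < n by lia.
  have := @alt (Ordinal ip) i [:: i] x; rewrite /= prednK // => /(_ erefl erefl).
  by rewrite (negbTE r) eqxx -val_eqE /=; lia.
apply/negP => r; case: (ltnP i.+1 n) => iSn; last first.
  by move: r; rewrite /goes_right north2 //; have := ltn_ord (d (north n i.+1)).2; lia.
have := @alt i (Ordinal iSn) [:: i] x erefl erefl.
by rewrite r /= eqxx -val_eqE /=; lia.
Qed.

Lemma uncapped_height d i d' : uncapped d i d' ->
  forall k, height d k = height d' k + (k == i).
Proof. by case=> _ w _ _ _ k; have := w k; rewrite !height_width; lia. Qed.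

(** Removing the first [i] lowers its count by one in every nonempty prefix, which exchanges the two
    forms of the alternation with each neighbour. This agrees with the directions at the two nodes
    of the cap, which the surgery reverses or makes vertical. *)
Lemma realizes_cons d i d' x : uncapped d i d' ->
  realizes d (i :: x) <-> realizes d' x.
Proof.
move=> unc; have hgt := uncapped_height unc; case: unc => cap _ dir nr nl.
have hi := ltn_ord i.
have rN : goes_right d (north n i) by rewrite /goes_right cap !north2 ?(ltnW hi).
have rM : goes_right d (north n i.+1) = false.
  by rewrite /goes_right -cap partnerK cap !north2 ?(ltnW hi) // ltnNge leqnSn.
have cnt_le (y u v : word n) k : y = u ++ v -> count_mem k u <= count_mem k y.
  by move=> ->; rewrite count_cat leq_addr.
(* When [d'] has a vertical edge at [M] the direction is not reversed, but then neither letter is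
   left in [x]. *)
have vert j : i.+1 = j :> nat -> ~~ goes_right d' (north n j) ->
    height d' i = 0 /\ height d' j = 0.
  move=> ij r; rewrite -ij in r; have [h1 h2] := vertical_height hi r nl.
  by rewrite -ij.
split=> -[cnt alt]; split.
- by move=> j; have := cnt j; rewrite /= hgt eq_sym -val_eqE /=; lia.
- move=> j k u v jk xuv; have := alt j k (i :: u) v jk; rewrite xuv => /(_ erefl) /=.
  have cj := cnt j; have ck := cnt k; rewrite /= !hgt in cj ck.
  have uj := cnt_le _ _ _ j xuv; have uk := cnt_le _ _ _ k xuv.
  have kn : k <= n by rewrite ltnW.
  rewrite !(eq_sym i) -!val_eqE /=.
  have [ji|ji] := eqVneq (j : nat) i.
    have ik : i.+1 = k :> nat by rewrite -jk ji.
    rewrite -ik rM (_ : i.+1 == i = false); last by lia.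
    rewrite ik; case: ifP => [_|/negbT r]; first by lia.
    have [] := vert _ ik r; move: cj ck uj uk; rewrite -!val_eqE /= ji; lia.
  have [ki|ki] := eqVneq (k : nat) i.
    by rewrite ki rN (negbTE nr); lia.
  have kSi : k <> i.+1 :> nat by move: ji => /eqP; lia.
  have [-> _] := dir k kn (elimN eqP ki) kSi.
  by case: ifP => _; move: ji ki kSi => /eqP + /eqP; lia.
- by move=> j; have := cnt j; rewrite /= hgt eq_sym -val_eqE /=; lia.
- move=> j k [|i' u] v jk /=; first by case: ifP.
  case=> <- xuv {i'}; have := alt j k u v jk xuv.
  have uj := cnt_le _ _ _ j xuv; have uk := cnt_le _ _ _ k xuv.
  have kn : k <= n by rewrite ltnW.
  rewrite !(eq_sym i) -!val_eqE /=.
  have [ji|ji] := eqVneq (j : nat) i.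
    have ik : i.+1 = k :> nat by rewrite -jk ji.
    rewrite -ik rM (_ : i.+1 == i = false); last by lia.
    rewrite ik; case: ifP => [_|/negbT r]; first by lia.
    have [] := vert _ ik r; move: uj uk; rewrite !cnt ji; rewrite /=; lia.
  have [ki|ki] := eqVneq (k : nat) i.
    by rewrite ki rN (negbTE nr); lia.
  have kSi : k <> i.+1 :> nat by move: ji => /eqP; lia.
  have [-> _] := dir k kn (elimN eqP ki) kSi.
  by case: ifP => _; move: ji ki kSi => /eqP + /eqP; lia.
Qed.

Lemma realizes_nil d : realizes d [::] -> d = id_diagram n.
Proof.
move=> [cnt _]; apply/val_inj/ffunP => u; rewrite ffunE.
have flat (w : node n) : ~~ goes_right d w.
  apply/negP => r; have wn : w.2 < n.
    by rewrite (leq_trans r) // -ltnS ltn_ord.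
  have := @width_gt0 _ d w.2 w; rewrite /crosses leqnn => /(_ r).
  by rewrite height_width -(cnt (Ordinal wn)).
apply: same_column; have := flat u; have := flat (d u).
by rewrite /goes_right partnerK; lia.
Qed.

Lemma word_diagram_realizes d x : realizes d x -> word_diagram x = dbasis d.
Proof.
elim: x d => [|i x IHx] d rx /=; first by rewrite (realizes_nil rx).
have [d' unc <-] := uncapped_exists (realizes_cap rx).
by rewrite (IHx d') //; apply/(realizes_cons _ unc).
Qed.

(** The rightmost north node going right starts a cap. If there were none, the heights would not
    increase from left to right, and they start at 0 because node 0 would be vertical. *)
Lemma cap_exists d k : 0 < height d k -> exists i : 'I_n, d (north n i) = north n i.+1.
Proof.
move=> hk; have kn : k < n.
  by apply: contraLR hk; rewrite -leqNgt => /(width_ge d) h; rewrite /height h.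
have [l lr] : exists l, (l <= n) && goes_right d (north n l).
  case: (pickP (fun l : 'I_n.+1 => goes_right d (north n l))) => [l lr|no].
    by exists l; rewrite lr -ltnS ltn_ord.
  have h0 l : l <= n -> height d l = 0.
    elim: l => [_|l IHl ln].
      have r0 : ~~ goes_right d (north n 0) by have := no ord0 => /= ->.
      have l0 : ~~ goes_left d (north n 0) by rewrite /goes_left north2.
      by have [-> _] := vertical_height (leq0n n) r0 l0.
    have := IHl (ltnW ln); have := @height_step_left _ d l ln.
    by have := no (Ordinal (ln : l.+1 < n.+1)) => /= ->; lia.
  by rewrite h0 // ltnW in hk.
have lmax l' : (l' <= n) && goes_right d (north n l') -> l' <= n by case/andP.
case: (@ex_maxnP _ n (ex_intro _ l lr) lmax) => i /andP[i_n ir] imax {l lr lmax}.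
have ilt : i < n.
  by move: ir; rewrite /goes_right north2 //; have := ltn_ord (d (north n i)).2; lia.
exists (Ordinal ilt); apply: cap_of_directions => //=.
  have := @width_gt0 _ d i (north n i); rewrite height_width double_gt0; apply.
  by rewrite /crosses north2 // leqnn /=; move: ir; rewrite /goes_right north2.
by apply/negP => r; have := imax i.+1; rewrite ilt r ltnn => /(_ isT).
Qed.

Lemma realizes_exists d : exists x, realizes d x.
Proof.
have [m] := ubnP (\sum_(i < n) height d i); elim: m d => // m IHm d hm.
case: (pickP (fun i : 'I_n => 0 < height d i)) => [i0 h0|flat]; last first.
  exists [::]; split=> [i|i j [|//] v _ _]; last by case: ifP.
  by have := flat i; rewrite lt0n => /negbFE/eqP.
have [i cap] := cap_exists h0; have [d' unc _] := uncapped_exists cap.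
have [x rx] : exists x, realizes d' x.
  apply: IHm; move: hm; rewrite (bigD1 i) //= [X in _ -> X < _](bigD1 i) //=.
  rewrite (eq_bigr (fun k : 'I_n => height d' k)); first by rewrite (uncapped_height unc) eqxx; lia.
  by move=> k ki; rewrite (uncapped_height unc) -[_ == _ :> nat]/(k == i) (negbTE ki) addn0.
by exists (i :: x); apply/(realizes_cons _ unc).
Qed.

End Realization.

(** * Commutations in realizing words *)

Section Commutation.
Variable n : nat.
Implicit Types (d : diagram n) (x y z u v : word n) (i j k l : 'I_n).

Lemma far_sym i j : far i j = far j i.
Proof. by rewrite /far orbC. Qed.

Lemma far_or_neighbors i j : i <> j -> ~~ far i j -> neighbors i j.
Proof.
by move=> ij; have : i <> j :> nat by [move/val_inj]; rewrite /far /neighbors; lia.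
Qed.

Lemma realizes_swap d u v i j : far i j ->
  realizes d (u ++ [:: i; j] ++ v) -> realizes d (u ++ [:: j; i] ++ v).
Proof.
move=> ij [cnt alt]; split=> [k|k l y z kl yz].
  by rewrite -cnt !count_cat /= !addn0; lia.
have prefix_y : y = take (size y) (u ++ [:: j; i] ++ v) by rewrite yz take_size_cat.
have alt' y' z' : u ++ [:: i; j] ++ v = y' ++ z' ->
    count_mem k y = count_mem k y' -> count_mem l y = count_mem l y' ->
    if goes_right d (north n l) then count_mem k y <= count_mem l y <= (count_mem k y).+1
    else count_mem l y <= count_mem k y <= (count_mem l y).+1.
  by move=> e -> ->; apply: alt e.
move: prefix_y; rewrite take_cat; case: ltnP => ysize.
  move=> yu; apply: (alt' y (drop (size y) u ++ [:: i; j] ++ v)) => //.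
  by rewrite [RHS]catA {1}yu cat_take_drop.
case: (size y - size u) => [|[|m]] /= => yu.
- by apply: (alt' u ([:: i; j] ++ v)); rewrite // yu ?take0 cats0.
(* Only the prefix ending between the two swapped letters is new. As [k] and [l] are neighbours,
   they do not include both [i] and [j]; the counts agree with those of the old prefix after both
   letters or before both. *)
- case: (boolP ((j == k) || (j == l))) => jkl.
    apply: (alt' (u ++ [:: i; j]) v); first by rewrite -catA.
      rewrite yu ?take0 !count_cat /= -!val_eqE /=; move: ij jkl.
      by rewrite /far -!val_eqE /=; lia.
    rewrite yu ?take0 !count_cat /= -!val_eqE /=; move: ij jkl.
    by rewrite /far -!val_eqE /=; lia.
  move: jkl; rewrite negb_or => /andP[/negbTE jk /negbTE jl].
  by apply: (alt' u ([:: i; j] ++ v)); rewrite // yu ?take0 count_cat /= ?jk ?jl !addn0.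
- apply: (alt' (u ++ [:: i; j] ++ take m v) (drop m v)).
  + by rewrite -!catA cat_take_drop.
  + by rewrite yu !count_cat /=; lia.
  + by rewrite yu !count_cat /=; lia.
Qed.

Lemma realizes_comm d x y : word_cong (@comm_rule n) x y ->
  realizes d x <-> realizes d y.
Proof.
elim=> {x y} [u v a b []|//|x y _ IH|x y z _ IHx _ IHy].
- by move=> i j ij; split; apply: realizes_swap; rewrite // far_sym.
- exact: iff_sym.
- exact: iff_trans IHx IHy.
Qed.

Lemma word_cong_cons (rule : word n -> word n -> Prop) i x y :
  word_cong rule x y -> word_cong rule (i :: x) (i :: y).
Proof.
elim=> {x y} [u v a b ab|x|x y _ IH|x y z _ IHx _ IHy].
- exact: (@CongRule _ rule (i :: u) v a b ab).
- exact: CongRefl.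
- exact: CongSym.
- exact: CongTrans IHx IHy.
Qed.

Lemma height_cap_gt0 d i : goes_right d (north n i) -> 0 < height d i.
Proof.
move=> r; have := @width_gt0 _ d i (north n i); rewrite height_width double_gt0; apply.
by move: r; rewrite /goes_right /crosses !north2 ?leqnn // ltnW.
Qed.

(** Caps over neighbouring columns would share a node, so a first letter other than [j] is far from
    [j]. Its removal leaves the cap at [j] in place, and [j] can later be moved across it. *)
Lemma realizes_front d x j : realizes d x -> d (north n j) = north n j.+1 ->
  exists z, word_cong (@comm_rule n) x (j :: z).
Proof.
have hj := ltn_ord j.
elim: x d => [|i x IHx] d rx capj.
  by move/(congr1 fst): capj; rewrite (realizes_nil rx) ffunE.
have [<-|/eqP ij] := eqVneq i j; first by exists x; apply: CongRefl.
have capi := realizes_cap rx; have hi := ltn_ord i.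
have ij_far : far i j.
  apply/negPn/negP => /(far_or_neighbors ij) /orP[]/eqP e.
    have := capj; rewrite -e -capi partnerK => /(congr1 (fun w : node n => w.2 : nat)).
    by rewrite !north2; lia.
  have := capi; rewrite -e -capj partnerK => /(congr1 (fun w : node n => w.2 : nat)).
  by rewrite !north2; lia.
have [d' unc _] := uncapped_exists capi.
have rx' := (realizes_cons x unc).1 rx.
have hgt := uncapped_height unc; have [_ _ dir _ _] := unc.
have capj' : d' (north n j) = north n j.+1.
  have rj : goes_right d (north n j) by rewrite /goes_right capj !north2; lia.
  apply: cap_of_directions => //.
  - have := hgt j; have := height_cap_gt0 rj; move: ij_far; rewrite /far; lia.
  - have ji : j <> i :> nat by move: ij_far; rewrite /far; lia.
    have jSi : j <> i.+1 :> nat by move: ij_far; rewrite /far; lia.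
    by have [-> _] := dir j (ltnW hj) ji jSi.
  have ji : j.+1 <> i :> nat by move: ij_far; rewrite /far; lia.
  have jSi : j.+1 <> i.+1 :> nat by move: ij_far; rewrite /far; lia.
  have [-> _] := dir j.+1 hj ji jSi.
  by rewrite /goes_right -capj partnerK capj !north2; lia.
have [z xz] := IHx d' rx' capj'; exists (i :: z).
apply: (CongTrans (word_cong_cons i xz)).
by apply: (@CongRule _ _ [::] z [:: i; j] [:: j; i]); apply: CommRule.
Qed.

End Commutation.

(** * Full commutativity *)

Section WordPerm.
Variable n : nat.
Implicit Types (d : diagram n) (x y z : word n) (i j : 'I_n) (k l : 'I_n.+1)
  (p : 'S_n.+1).

Definition lnode i : 'I_n.+1 := inord i.
Definition rnode i : 'I_n.+1 := inord i.+1.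

Lemma val_lnode i : lnode i = i :> nat.
Proof. by rewrite inordK // ltnW // ltnS. Qed.

Lemma val_rnode i : rnode i = i.+1 :> nat.
Proof. by rewrite inordK // ltnS. Qed.

Definition transp i : 'S_n.+1 := tperm (lnode i) (rnode i).

(** Products of permutations act from left to right, so the first letter acts first, on positions,
    just as the corresponding cap sits at the north face. *)
Definition word_perm x : 'S_n.+1 := (\prod_(i <- x) transp i)%g.

Lemma word_perm_cons i x : word_perm (i :: x) = (transp i * word_perm x)%g.
Proof. by rewrite /word_perm big_cons. Qed.

Lemma word_perm_cat x y : word_perm (x ++ y) = (word_perm x * word_perm y)%g.
Proof. by rewrite /word_perm big_cat. Qed.

Lemma val_transp i k :
  transp i k = (if (k : nat) == i then i.+1 else if (k : nat) == i.+1 then i : nat else k) :> nat.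
Proof.
rewrite /transp; case: tpermP => [->|->|].
- by rewrite val_lnode val_rnode eqxx.
- by rewrite val_lnode val_rnode eqxx; case: eqP => //; lia.
move=> kl kr; have kl' : k <> i :> nat by rewrite -val_lnode => /val_inj.
have kr' : k <> i.+1 :> nat by rewrite -val_rnode => /val_inj.
by move/eqP/negbTE: kl' => ->; move/eqP/negbTE: kr' => ->.
Qed.

Lemma word_perm_cong x y : word_cong (@cox_rule n) x y -> word_perm x = word_perm y.
Proof.
elim=> {x y} [u v a b ab|//|x y _ //|x y z _ -> _ -> //].
rewrite !word_perm_cat; congr (_ * (_ * _))%g; apply/permP => k.
case: ab => [i|i j|i j]; rewrite !word_perm_cons /word_perm !big_nil !mulg1 !permM.
- by rewrite tpermK perm1.
- rewrite /far => ij; apply: val_inj; rewrite /= !val_transp.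
  by do !case: eqP => //=; lia.
- rewrite /neighbors => ij; apply: val_inj; rewrite /= !val_transp.
  by do !case: eqP => //=; lia.
Qed.

Lemma word_elt_eq x y : word_elt x = word_elt y <-> word_cong (@cox_rule n) x y.
Proof.
split=> [/eqmodP|xy]; first by move=> h; apply/asboolP; exact: h.
by apply/eqmodP/asboolP.
Qed.

(** Permutations separate the two products of neighbouring generators. This ties [commuting] in the
    group, on which the heap is built, to adjacency of columns. *)
Lemma commutingE i j : commuting i j <-> ~~ neighbors i j.
Proof.
rewrite /commuting word_elt_eq; split=> [|ij].
  move/word_perm_cong => e; apply/negP => ij.
  have := congr1 (fun p => val (p (lnode i))) e; have := congr1 (fun p => val (p (lnode j))) e.
  rewrite /= !word_perm_cons /word_perm !big_nil !mulg1 !permM !val_transp val_lnode.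
  by move: ij; rewrite /neighbors val_lnode; do !case: eqP => //=; lia.
have [<-|/eqP ne] := eqVneq i j; first exact: CongRefl.
apply: (@CongRule _ _ [::] [::] [:: i; j] [:: j; i]); apply: CoxComm.
by apply: contraR ij => /(far_or_neighbors ne).
Qed.

Definition inversions p := \sum_(k : 'I_n.+1) \sum_(l : 'I_n.+1) ((k < l) && (p l < p k) : nat).

Lemma inversions1 : inversions 1 = 0.
Proof. by apply: big1 => k _; apply: big1 => l _; rewrite !perm1; lia. Qed.

Lemma inversions_up i p : p (lnode i) < p (rnode i) ->
  inversions (transp i * p)%g = (inversions p).+1.
Proof.
move=> lt_i; rewrite -[RHS]addn1 /inversions (reindex_inj (@perm_inj _ (transp i))) /=.
under eq_bigr => k _ do rewrite (reindex_inj (@perm_inj _ (transp i))) /=.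
(* After the substitution, [k = rnode i] and [l = lnode i] is the only pair whose summand differs
   from that for [p]: it is the new inversion. *)
have <- : \sum_(k : 'I_n.+1) \sum_(l : 'I_n.+1)
    ((l == lnode i) && (k == rnode i) : nat) = 1.
  rewrite (bigD1 (rnode i)) //= (bigD1 (lnode i)) //= !eqxx.
  rewrite big1 ?addn0 => [|l /negbTE-> //].
  by rewrite big1 ?addn0 // => k /negbTE ->; apply: big1 => l _; rewrite andbF.
rewrite -big_split; apply: eq_bigr => k _; rewrite -big_split; apply: eq_bigr => l _ /=.
rewrite !permM.
rewrite /transp !tpermK -/(transp i) !val_transp -!val_eqE /= val_lnode val_rnode.
have [kl|kl] := k =P lnode i; first have [lr|lr] := l =P rnode i.
- by rewrite kl lr val_lnode val_rnode; move: lt_i; do !case: eqP => //=; lia.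
- have kl' : k = i :> nat by rewrite kl val_lnode.
  have lr' : l <> i.+1 :> nat by rewrite -val_rnode => /val_inj.
  by do !case: eqP => //= *; rewrite ?addn0 //; lia.
have kl' : k <> i :> nat by rewrite -val_lnode => /val_inj.
have [kr|kr] := k =P rnode i; last first.
  have kr' : k <> i.+1 :> nat by rewrite -val_rnode => /val_inj.
  by do !case: eqP => //= *; rewrite ?addn0 //; lia.
have kr' : k = i.+1 :> nat by rewrite kr val_rnode.
have [lr|lr] := l =P lnode i.
  by rewrite kr lr val_lnode val_rnode; move: lt_i; do !case: eqP => //=; lia.
have lr' : l <> i :> nat by rewrite -val_lnode => /val_inj.
by do !case: eqP => //=; lia.
Qed.

Lemma inversions_step i x :
  word_perm x (lnode i) < word_perm x (rnode i) ->
  inversions (word_perm (i :: x)) = (inversions (word_perm x)).+1.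
Proof. by rewrite word_perm_cons; exact: inversions_up. Qed.

Lemma inversions_descent i x :
  word_perm (i :: x) (lnode i) < word_perm (i :: x) (rnode i) ->
  inversions (word_perm x) = (inversions (word_perm (i :: x))).+1.
Proof. by move/inversions_up => <-; rewrite word_perm_cons mulgA tperm2 mul1g. Qed.

Lemma lnode_rnode i p : p (lnode i) < p (rnode i) \/ p (rnode i) < p (lnode i).
Proof.
case: (ltngtP (p (lnode i)) (p (rnode i))) => [||/val_inj/perm_inj]; [by left|by right|].
by move/(congr1 val); rewrite /= val_lnode val_rnode; lia.
Qed.

(** Each letter changes the number of inversions by exactly one. This bound makes realizing words
    reduced, since their inversions attain it. *)
Lemma inversions_size x : inversions (word_perm x) <= size x.
Proof.
elim: x => [|i x IHx]; first by rewrite /word_perm big_nil inversions1.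
case: (lnode_rnode i (word_perm x)) => [/inversions_step -> //|h].
have : word_perm (i :: x) (lnode i) < word_perm (i :: x) (rnode i).
  by rewrite word_perm_cons !permM tpermL tpermR.
by move/inversions_descent => e /=; rewrite e in IHx; lia.
Qed.

End WordPerm.

(** * Permutations of realizing words *)

Section FullyCommutative.
Variable n : nat.
Implicit Types (d : diagram n) (x y z : word n) (i j : 'I_n) (k l : 'I_n.+1)
  (p : 'S_n.+1).

Lemma word_perm_cons_lnode i x : word_perm (i :: x) (lnode i) = word_perm x (rnode i).
Proof. by rewrite word_perm_cons permM tpermL. Qed.

Lemma word_perm_cons_rnode i x : word_perm (i :: x) (rnode i) = word_perm x (lnode i).
Proof. by rewrite word_perm_cons permM tpermR. Qed.

Lemma word_perm_cons_other i x k : k <> lnode i -> k <> rnode i ->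
  word_perm (i :: x) k = word_perm x k.
Proof. by move=> /eqP kl /eqP kr; rewrite word_perm_cons permM tpermD // eq_sym. Qed.

(** In the diagram with the cap removed, [M] does not go left, so [x] sends it to at least [i.+1].
    The letter [i] first sends [N] to [M], whence [N] moves right; symmetrically [M] moves left. *)
Lemma realizes_direction d x k : realizes d x ->
  goes_right d (true, k) = (k < word_perm x k) /\
  goes_left d (true, k) = (word_perm x k < k).
Proof.
elim: x d k => [|i x IHx] d k rx.
  rewrite (realizes_nil rx) /word_perm big_nil perm1 /goes_right /goes_left ffunE /=.
  by rewrite ltnn.
have capi := realizes_cap rx; have hi := ltn_ord i.
have [d' unc _] := uncapped_exists capi; have [_ _ dir nr nl] := unc.
have {}IHx := IHx d' ^~ ((realizes_cons x unc).1 rx).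
have [kl|kl] := k =P lnode i.
  have := IHx (rnode i); rewrite -/(north n i.+1) (negbTE nl) => -[_].
  rewrite kl word_perm_cons_lnode -/(north n i) /goes_right /goes_left capi.
  by rewrite val_lnode val_rnode ?north2; lia.
have [kr|kr] := k =P rnode i.
  have := IHx (lnode i); rewrite -/(north n i) (negbTE nr) => -[+ _].
  rewrite kr word_perm_cons_rnode -/(north n i.+1) /goes_right /goes_left -capi partnerK capi.
  by rewrite val_lnode val_rnode ?north2; lia.
rewrite word_perm_cons_other // -(IHx k).1 -(IHx k).2.
have ki : k <> i :> nat by rewrite -(val_lnode i) => /val_inj.
have kSi : k <> i.+1 :> nat by rewrite -(val_rnode i) => /val_inj.
have kn : k <= n by rewrite -ltnS.
by have := dir k kn ki kSi; rewrite /north inord_val => -[-> ->].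
Qed.

(* Together with realizes_direction, this says that word_perm x avoids the pattern 321. *)
Lemma realizes_monotone d x k l : realizes d x -> k < l ->
  (k <= word_perm x k -> l <= word_perm x l -> word_perm x k < word_perm x l) /\
  (word_perm x k <= k -> word_perm x l <= l -> word_perm x k < word_perm x l).
Proof.
elim: x d k l => [|i x IHx] d k l rx kl.
  by rewrite /word_perm big_nil !perm1.
have [d' unc _] := uncapped_exists (realizes_cap rx); have [_ _ _ nr nl] := unc.
have rx' := (realizes_cons x unc).1 rx.
have downL := (realizes_direction (lnode i) rx').1.
rewrite -/(north n i) (negbTE nr) val_lnode in downL.
have upR := (realizes_direction (rnode i) rx').2.
rewrite -/(north n i.+1) (negbTE nl) val_rnode in upR.
have vl := val_lnode i; have vr := val_rnode i.
rewrite word_perm_cons !permM.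
(* A position that weakly moves right is never [i.+1], and [transp i] is increasing on the other
   positions. Symmetrically, a position that weakly moves left is never [i]. *)
have up (a : 'I_n.+1) : a <= word_perm x (transp i a) ->
    transp i a <= word_perm x (transp i a) /\ a <> i.+1 :> nat.
  rewrite val_transp; case: eqP => [/eqP ai|ai].
    have -> : a = lnode i by apply: val_inj; rewrite /= (eqP ai) vl.
    by rewrite tpermL vl; lia.
  case: eqP => // aSi; have -> : a = rnode i by apply: val_inj; rewrite /= aSi vr.
  by rewrite tpermR vr; lia.
have down (a : 'I_n.+1) : word_perm x (transp i a) <= a ->
    word_perm x (transp i a) <= transp i a /\ a <> i :> nat.
  rewrite val_transp; case: eqP => [/eqP ai|ai].
    have -> : a = lnode i by apply: val_inj; rewrite /= (eqP ai) vl.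
    by rewrite tpermL vl; lia.
  case: eqP => // aSi; have -> : a = rnode i by apply: val_inj; rewrite /= aSi vr.
  by rewrite tpermR vr; lia.
split=> [/up[ek kR] /up[el lR]|/down[ek kL] /down[el lL]].
  apply: (proj1 (IHx d' _ _ rx' _)) => //.
  by rewrite !val_transp; do !case: eqP; lia.
apply: (proj2 (IHx d' _ _ rx' _)) => //.
by rewrite !val_transp; do !case: eqP; lia.
Qed.

Lemma realizes_descent_cap d x j : realizes d x ->
  word_perm x (rnode j) < word_perm x (lnode j) -> d (north n j) = north n j.+1.
Proof.
move=> rx desc; have hj := ltn_ord j.
have lr : lnode j < rnode j by rewrite val_lnode val_rnode.
have [mono1 mono2] := realizes_monotone rx lr.
have [dirL _] := realizes_direction (lnode j) rx.
have [dirR _] := realizes_direction (rnode j) rx.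
move: lr dirL dirR mono1 mono2; rewrite val_lnode val_rnode -/(north n j) -/(north n j.+1).
move=> _ dirL dirR mono1 mono2.
have r : goes_right d (north n j) by rewrite dirL; move: mono1 mono2 desc; lia.
apply: cap_of_directions => //; first exact: height_cap_gt0.
by rewrite dirR -leqNgt; move: mono1 mono2 desc; lia.
Qed.

Lemma realizes_inversions d x : realizes d x -> inversions (word_perm x) = size x.
Proof.
elim: x d => [|i x IHx] d rx; first by rewrite /word_perm big_nil inversions1.
have [d' unc _] := uncapped_exists (realizes_cap rx); have [_ _ _ nr nl] := unc.
have rx' := (realizes_cons x unc).1 rx.
rewrite inversions_step ?(IHx _ rx') //.
have := (realizes_direction (lnode i) rx').1; have := (realizes_direction (rnode i) rx').2.
rewrite -/(north n i) -/(north n i.+1) (negbTE nr) (negbTE nl) val_lnode val_rnode; lia.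
Qed.

Lemma word_perm_comm x y : word_cong (@comm_rule n) x y -> word_perm x = word_perm y.
Proof.
move=> xy; apply: word_perm_cong; elim: xy => {x y} [u v a b [i j ij]|x|x y _|x y z _ + _].
- exact/CongRule/CoxComm.
- exact: CongRefl.
- exact: CongSym.
- exact: CongTrans.
Qed.

(** If the first letter [j] of [y] were not a descent, the rest of [y] would have more inversions
    than letters. So [j] is a cap of [d], moves to the front of [x] by commutations, and cancels on
    both sides. *)
Lemma realizes_comm_unique d x y : realizes d x -> word_perm y = word_perm x ->
  size y <= size x -> word_cong (@comm_rule n) x y.
Proof.
elim: y d x => [|j y IHy] d x rx pyx yx.
  have := realizes_inversions rx; rewrite -pyx /word_perm big_nil inversions1.
  by case: x {rx pyx yx} => // _; apply: CongRefl.
have invx := realizes_inversions rx.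
have capj : d (north n j) = north n j.+1.
  apply: (realizes_descent_cap rx); rewrite -pyx.
  case: (lnode_rnode j (word_perm (j :: y))) => // /inversions_descent.
  by have := inversions_size y; rewrite pyx invx; move: yx => /=; lia.
have [z xz] := realizes_front rx capj.
have rz := (realizes_comm d xz).1 rx.
have [d' unc _] := uncapped_exists capj; have rz' := (realizes_cons z unc).1 rz.
have pz : word_perm (j :: z) = word_perm x by rewrite (word_perm_comm xz).
have sz : size (j :: z) = size x by rewrite -(realizes_inversions rz) pz.
apply: (CongTrans xz); apply: word_cong_cons; apply: (IHy d') => //.
  by move: pyx; rewrite -pz !word_perm_cons => /mulgI.
by move: yx; rewrite -sz.
Qed.

Lemma realizes_reduced d x y : realizes d x ->
  reduced_expr (word_elt x) y -> word_cong (@comm_rule n) x y.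
Proof.
move=> rx [/word_elt_eq/word_perm_cong yx ymin].
exact: (realizes_comm_unique rx yx (ymin x erefl)).
Qed.

Lemma realizes_fully_commutative d x : realizes d x -> fully_commutative (word_elt x).
Proof.
move=> rx y z ry rz; apply: CongTrans (realizes_reduced rx rz).
exact/CongSym/(realizes_reduced rx ry).
Qed.

End FullyCommutative.

(** * Heaps *)

Section Coordinates.
Variables (n : nat) (d : diagram n).

(* (i, t) stands for the t-th element from the top among those labeled s_i. *)
Definition coord_arrow (i : 'I_n) (t : nat) (j : 'I_n) (t' : nat) : Prop :=
  (i.+1 = j :> nat /\ t' = t + goes_right d (north n j)) \/
  (j.+1 = i :> nat /\ t' = t + ~~ goes_right d (north n i)).

(** Labels and levels identify [G] with a model that depends only on [d], so any two coordinatized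
    graphs are isomorphic. *)
Definition coordinatized (G : ldigraph 'I_n) (lev : vertex G -> nat) : Prop :=
  [/\ forall u v, vlabel u = vlabel v -> lev u = lev v -> u = v,
      forall u, lev u < height d (vlabel u),
      forall (i : 'I_n) t, t < height d i -> exists u : vertex G, vlabel u = i /\ lev u = t
    & forall u v : vertex G, arrow u v <->
        coord_arrow (vlabel u) (lev u) (vlabel v) (lev v)].

Lemma coordinatized_iso G H levG levH :
  @coordinatized G levG -> @coordinatized H levH -> ldigraph_iso G H.
Proof.
move=> [injG boundG surjG arrowG] [injH boundH surjH arrowH].
have [f fP] := choice (fun u => surjH _ _ (boundG u)).
have [g gP] := choice (fun v => surjG _ _ (boundH v)).
exists f; split.
- exists g => u.
    by apply: injG; [rewrite (gP _).1 (fP _).1|rewrite (gP _).2 (fP _).2].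
  by apply: injH; [rewrite (fP _).1 (gP _).1|rewrite (fP _).2 (gP _).2].
- by move=> u; case: (fP u).
- move=> u v; rewrite arrowG arrowH.
  by rewrite (fP u).1 (fP v).1 (fP u).2 (fP v).2.
Qed.

Variable x : word n.
Hypothesis rx : realizes d x.

Let lab (p : 'I_(size x)) : 'I_n := heap_label p.
Definition heap_level (p : 'I_(size x)) : nat := count_mem (heap_label p) (take p x).

Let take_lt_count (p : 'I_(size x)) m (a : pred 'I_n) : p < m ->
  count a (take p x) + a (lab p) <= count a (take m x).
Proof.
move=> pm; rewrite -(cat_take_drop p.+1 (take m x)) count_cat take_takel //.
rewrite (take_nth (lab p)) // -cats1 count_cat /= addn0 -addnA leq_add2l.
have e : nth (lab p) x p = lab p by rewrite [RHS]/lab /heap_label [RHS](tnth_nth (lab p)).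
by rewrite e leq_addr.
Qed.

Let level_lt_height p : heap_level p < height d (lab p).
Proof.
have [cnt _] := rx; rewrite -cnt -[in X in _ < X](take_size x).
by have := take_lt_count (pred1 (lab p)) (ltn_ord p); rewrite /= eqxx addn1.
Qed.

Let level_mono p q : lab p = lab q -> p < q -> heap_level p < heap_level q.
Proof.
move=> e pq; have := take_lt_count (pred1 (lab p)) pq.
by rewrite /= eqxx addn1 {2}e /heap_level -/(lab p) -/(lab q) e.
Qed.

Let level_lt p q : lab p = lab q -> (p < q) = (heap_level p < heap_level q).
Proof.
move=> e; case: (ltngtP p q) => [/(level_mono e) ->//|/level_mono h|/val_inj ->].
  by have := h (esym e); lia.
by rewrite ltnn.
Qed.

Let level_inj p q : lab p = lab q -> heap_level p = heap_level q -> p = q.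
Proof.
move=> e h; apply: val_inj; have := level_lt e; have := level_lt (esym e).
by rewrite h ltnn /=; lia.
Qed.

Let occurrence (T : eqType) (a : T) (s : seq T) t : t < count_mem a s ->
  exists2 m, m < size s & nth a s m = a /\ count_mem a (take m s) = t.
Proof.
elim: s t => [|b s IHs] t //=; case: (eqVneq b a) => [->|ba].
  case: t => [_|t /IHs[m ms [e c]]]; first by exists 0.
  by exists m.+1; rewrite //= eqxx c.
by rewrite add0n => /IHs[m ms [e c]]; exists m.+1; rewrite //= (negbTE ba).
Qed.

Let level_surj (i : 'I_n) t : t < height d i -> exists p, lab p = i /\ heap_level p = t.
Proof.
have [<- _] := rx; case/occurrence => m mx [e c]; exists (Ordinal mx).
have le : lab (Ordinal mx) = i by rewrite /lab /heap_label (tnth_nth i).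
by rewrite /heap_level -/(lab _) le.
Qed.

(** Each case reads the alternation in the prefix that stops just before the later of the two
    positions. *)
Let level_next (p q : 'I_(size x)) : (lab p).+1 = lab q :> nat ->
  (p < q) = (heap_level p + goes_right d (north n (lab q)) <= heap_level q).
Proof.
move=> pq; have [_ alt] := rx.
have ne : (lab p == lab q) = false.
  by apply/negbTE/negP => /eqP e; move: pq; rewrite e; lia.
have alt_p := alt _ _ _ _ pq (esym (cat_take_drop p x)).
have alt_q := alt _ _ _ _ pq (esym (cat_take_drop q x)).
rewrite /heap_level -/(lab p) -/(lab q).
case: (ltngtP p q) => [lt_pq|lt_qp|/val_inj e].
- have := take_lt_count (pred1 (lab p)) lt_pq; rewrite /= eqxx /= => h.
  by move: alt_q; case: (goes_right _ _) => /=; lia.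
- have := take_lt_count (pred1 (lab q)) lt_qp; rewrite /= eqxx /= => h.
  by move: alt_p; case: (goes_right _ _) => /=; lia.
by move: pq; rewrite e; lia.
Qed.

Let noncommuting (i j : 'I_n) : ~ commuting i j <-> neighbors i j.
Proof. by rewrite commutingE; split=> [/negP/negPn//|h]; apply/negP; rewrite negbK. Qed.

Let gen_cases q p : heap_gen q p <->
  (p < q /\ (neighbors (lab p) (lab q) \/ lab p = lab q)).
Proof. by rewrite /heap_gen noncommuting. Qed.

(* The signs are chosen so that coord_arrow raises the depth by exactly one. *)
Let depth (p : 'I_(size x)) : nat :=
  (heap_level p + \sum_(k < lab p) ~~ goes_right d (north n k.+1)).*2 + (n - lab p).

Let depth_gen q p : heap_gen q p -> depth p < depth q.
Proof.
move/gen_cases => [pq [/orP[/eqP e|/eqP e]|e]]; rewrite /depth.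
- have hq := ltn_ord (lab q); move: pq; rewrite (level_next e) -e big_ord_recr /=.
  by case: (goes_right _ _) => /=; lia.
- have hp := ltn_ord (lab p); move: pq.
  have -> : (p < q) = ~~ (q < p).
    by case: (ltngtP p q) => // /val_inj pq; move: e; rewrite pq; lia.
  by rewrite (level_next e) -e big_ord_recr /=; case: (goes_right _ _) => /=; lia.
- by rewrite -e; move: pq; rewrite (level_lt e); lia.
Qed.

Let depth_heap q p : heap_lt q p -> depth p < depth q.
Proof.
elim=> {p q} [q p /depth_gen//|q m p _ h1 _ h2]; exact: ltn_trans h2 h1.
Qed.

Let arrow_gen p q : coord_arrow (lab p) (heap_level p) (lab q) (heap_level q) ->
  heap_gen q p /\ depth q = (depth p).+1.
Proof.
case=> -[e h]; rewrite gen_cases /neighbors e eqxx ?orbT; split.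
- by split; [rewrite level_next // h|left].
- have hq := ltn_ord (lab q).
  by rewrite /depth h -e big_ord_recr /=; case: (goes_right _ _) => /=; lia.
- split; last by left.
  have -> : (p < q) = ~~ (q < p).
    by case: (ltngtP p q) => // /val_inj pq; move: e; rewrite pq; lia.
  by rewrite level_next // h; case: (goes_right _ _) => /=; lia.
- have hp := ltn_ord (lab p).
  by rewrite /depth h -e big_ord_recr /=; case: (goes_right _ _) => /=; lia.
Qed.

(** For neighbouring labels, the first letter labelled as [q] after [p] lies between unless it is
    [q]. Equal labels always enclose a letter of the column to the left: this column exists, because
    column 0 has height at most one. *)
Let gen_arrow q p : heap_gen q p -> (forall m, ~ (heap_gen q m /\ heap_gen m p)) ->
  coord_arrow (lab p) (heap_level p) (lab q) (heap_level q).
Proof.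
move=> gqp nomid; have lp := level_lt_height p; have lq := level_lt_height q.
have [pq] := (gen_cases q p).1 gqp; case=> [/orP[/eqP e|/eqP e]|e].
- left; split=> //; move: pq; rewrite (level_next e) leq_eqVlt => /orP[/eqP//|lt_q].
  have [m [ml mt]] := level_surj (ltn_trans lt_q lq); case: (nomid m); split.
    by apply/gen_cases; split; [rewrite level_lt ?mt|right].
  apply/gen_cases; rewrite /neighbors ml e eqxx; split; last by left.
  by rewrite level_next ?ml // mt.
- right; split=> //.
  have nlt (a b : 'I_(size x)) : (lab b).+1 = lab a :> nat -> (a < b) = ~~ (b < a).
    by move=> ab; case: (ltngtP a b) => // /val_inj eab; move: ab; rewrite eab; lia.
  move: pq; rewrite (nlt _ _ e) (level_next e) => pq.
  have [//|lt_q] := eqVneq (heap_level q)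
     (heap_level p + ~~ goes_right d (north n (lab p))).
  have lt_q' : heap_level p + ~~ goes_right d (north n (lab p)) < heap_level q.
    by move: pq lt_q; case: (goes_right _ _) => /=; lia.
  have [m [ml mt]] := level_surj (ltn_trans lt_q' lq); case: (nomid m); split.
    by apply/gen_cases; split; [rewrite level_lt ?mt|right].
  apply/gen_cases; rewrite /neighbors ml e eqxx orbT; split; last by left.
  by rewrite nlt ?ml // level_next ?ml // mt; case: (goes_right _ _) => /=; lia.
- exfalso; move: pq; rewrite (level_lt e) => lt_pq.
  have hi := ltn_ord (lab p); rewrite -e in lq.
  case: (posnP (lab p)) => [i0|i_gt0].
    by have := height0_le1 d; rewrite i0 in lq; lia.
  have j_lt : (lab p).-1 < n by lia.
  pose j := Ordinal j_lt; have ji : j.+1 = lab p :> nat by rewrite /= prednK.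
  set s : nat := ~~ goes_right d (north n (lab p)).
  have lt_j : heap_level p + s < height d j.
    have jn : (lab p).-1 < n by [].
    have := @height_step_right _ d _ jn; have := @height_step_left _ d _ jn.
    by rewrite prednK // /s /=; case: (goes_right _ _) => /=; lia.
  have [m [ml mt]] := level_surj lt_j; case: (nomid m); split; apply/gen_cases.
    rewrite /neighbors ml -e ji eqxx; split; last by left.
    rewrite level_next ?ml -?e // mt /s.
    by case: (goes_right _ _) => /=; lia.
  rewrite /neighbors ml ji eqxx orbT; split; last by left.
  have -> : (p < m) = ~~ (m < p).
    by case: (ltngtP p m) => // /val_inj pm; move: ji; rewrite -ml pm; lia.
  by rewrite level_next ?ml // mt /s; case: (goes_right _ _) => /=; lia.
Qed.

(** A cover is a single generating relation with nothing between. Conversely, an arrow changes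
    [depth] by one and every heap relation changes it strictly in the same sense, which leaves no
    room for a third element. *)
Lemma heap_coordinatized : @coordinatized (heap_hasse x) heap_level.
Proof.
split=> [|||p q].
- exact: level_inj.
- exact: level_lt_height.
- exact: level_surj.
split=> [[qp nomid]|/arrow_gen[gqp depthS]]; last first.
  split=> [|m [/depth_heap qm /depth_heap mp]]; first exact: t_step.
  by rewrite depthS in qm; lia.
apply: gen_arrow => [|m [qm mp]]; last by apply: (nomid m); split; apply: t_step.
case: (clos_trans_t1n _ _ _ _ qp) nomid => [//|m r qm mr nomid].
by case: (nomid m); split; [apply: t_step|apply: clos_t1n_trans].
Qed.

End Coordinates.

(** * Regions of a drawing *)

Section EdgeGraphs.
Import Order.TTheory GRing.Theory Num.Theory numFieldNormedType.Exports.
Local Open Scope classical_set_scope.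
Local Open Scope ring_scope.

Lemma within_continuous_comp (T U V : topologicalType) (B : set T) (A : set U)
    (f : U -> V) (g : T -> U) : (forall x, B x -> A (g x)) ->
  {within B, continuous g} -> {within A, continuous f} ->
  {within B, continuous (f \o g)}.
Proof.
move=> BA /subspace_continuousP cg /subspace_continuousP cf.
apply/subspace_continuousP => x Bx P /(cf _ (BA _ Bx)) fP.
have := cg x Bx _ fP; rewrite /nbhs /= /within /=.
by apply: filterS => y h By; apply: h => //; apply: BA.
Qed.

Variables (R : realType) (n : nat) (d : diagram n) (D : drawing R d).
Implicit Types (u v : node n) (t x y : R) (p q : R * R).

Definition node_abscissa (k : nat) : R := k.+1%:R.
Definition in_range u x := node_abscissa u.2 <= x <= node_abscissa (d u).2.

Lemma node_abscissa_lt k l : (node_abscissa k < node_abscissa l) = (k < l)%N.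
Proof. by rewrite ltr_nat. Qed.

Lemma node_abscissa_le k l : (node_abscissa k <= node_abscissa l) = (k <= l)%N.
Proof. by rewrite ler_nat. Qed.

Lemma zero_in01 : (0 : R) \in `[0, 1]. Proof. by rewrite in_itv /= lexx ler01. Qed.
Lemma one_in01 : (1 : R) \in `[0, 1]. Proof. by rewrite in_itv /= lexx ler01. Qed.

Lemma curve_fst_continuous u : {within `[0, 1], continuous (fun t => (curve D u t).1)}.
Proof.
apply: (@within_continuous_comp _ _ _ _ setT fst (curve D u)) => //.
  exact: curve_continuous.
by apply: continuous_subspaceT => p; exact: cvg_fst.
Qed.

Lemma curve_snd_continuous u : {within `[0, 1], continuous (fun t => (curve D u t).2)}.
Proof.
apply: (@within_continuous_comp _ _ _ _ setT snd (curve D u)) => //.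
  exact: curve_continuous.
by apply: continuous_subspaceT => p; exact: cvg_snd.
Qed.

Lemma curve_fst_inj u : goes_right d u -> {in `[0, 1] &, injective (fun t => (curve D u t).1)}.
Proof.
move=> ru; case: (curve_no_double_back D u) => // cst.
have := cst 1 one_in01; rewrite curve_target /node_pt /= => /eqP.
by rewrite eqr_nat eqSS => /eqP e; move: ru; rewrite /goes_right e ltnn.
Qed.

Lemma curve_fst_range u t : goes_right d u -> t \in `[0, 1] -> in_range u (curve D u t).1.
Proof.
move=> ru t01; have le01 : (curve D u 0).1 <= (curve D u 1).1.
  by rewrite curve_source curve_target /= -!/(node_abscissa _) node_abscissa_le ltnW.
have mono := segment_continuous_inj_le le01 (curve_fst_continuous (u := u)) (curve_fst_inj ru).
have := mono 0 t zero_in01 t01; have := mono t 1 t01 one_in01.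
rewrite /= curve_source curve_target /= -!/(node_abscissa _) /in_range => -> ->.
by move: t01; rewrite in_itv /= andbC.
Qed.

Lemma curve_fst_surj u x : goes_right d u -> in_range u x ->
  exists2 t, t \in `[0, 1] & (curve D u t).1 = x.
Proof.
move=> ru ux; apply: (IVT ler01 (curve_fst_continuous (u := u))).
rewrite /= curve_source curve_target /= -!/(node_abscissa _).
by rewrite min_l ?max_r ?node_abscissa_le // ltnW.
Qed.

(** The abscissa is a continuous injection of the parameter, hence has a continuous inverse [g] on
    its range, and the edge is the graph of the ordinate composed with [g]. *)
Lemma edge_graph_exists u : goes_right d u -> exists2 F : R -> R, continuous F &
  {in `[0, 1], forall t, F (curve D u t).1 = (curve D u t).2}.
Proof.
move=> ru; pose f t := (curve D u t).1.
pose g (x : R) : R := xget 0 [set t | t \in `[0, 1] /\ f t = x].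
have fK : {in `[0, 1], cancel f g}.
  move=> t t01; rewrite /g; case: xgetP => [s _ [s01 fs]|/(_ t)[]//].
  exact: (curve_fst_inj ru).
have g01 x : g x \in `[0, 1].
  by rewrite /g; case: xgetP => [s _ []//|_]; exact: zero_in01.
have cg := segment_can_le_continuous ler01 (curve_fst_continuous (u := u)) fK.
(* Clamping continues the graph by constants beyond its two ends, so that [F] is continuous on the
   whole line. *)
pose clamp x := Num.max (f 0) (Num.min x (f 1)).
have f01 : f 0 <= f 1.
  by rewrite /f curve_source curve_target /= -!/(node_abscissa _) node_abscissa_le ltnW.
have cclamp : continuous clamp.
  move=> x; apply: (@continuous_max R R (fun=> f 0) (fun x => Num.min x (f 1)) x).
    exact: cvg_cst.
  by apply: (@continuous_min R R id (fun=> f 1) x); [exact: cvg_id|exact: cvg_cst].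
have clamp_in x : clamp x \in `[f 0, f 1].
  by rewrite in_itv /= /clamp le_max lexx /= ge_max f01 ge_min lexx orbT.
exists (fun x => (curve D u (g (clamp x))).2).
  apply/continuous_subspace_setT.
  apply: (@within_continuous_comp R R R setT `[f 0, f 1] ((fun t => (curve D u t).2) \o g)).
  - by move=> x _; exact: clamp_in.
  - exact: continuous_subspaceT.
  apply: (@within_continuous_comp R R R `[f 0, f 1] `[0, 1] (fun t => (curve D u t).2) g).
  - by move=> x _; exact: g01.
  - exact: cg.
  - exact: curve_snd_continuous.
move=> t t01; rewrite -/(f t).
have /andP[h1 h2] := curve_fst_range ru t01.
have -> : clamp (f t) = f t.
  rewrite /clamp min_l ?max_r //; first by rewrite /f curve_source.
  by rewrite {2}/f curve_target.
by rewrite fK.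
Qed.

Lemma edge_graphs_exist : exists F : node n -> R -> R,
  (forall u, goes_right d u -> continuous (F u)) /\
  (forall u t, goes_right d u -> t \in `[0, 1] -> F u (curve D u t).1 = (curve D u t).2).
Proof.
have /choice[F FP] : forall u, exists F : R -> R, goes_right d u ->
    continuous F /\ {in `[0, 1], forall t, F (curve D u t).1 = (curve D u t).2}.
  move=> u; case: (boolP (goes_right d u)) => [/edge_graph_exists[F cF FE]|_]; first by exists F.
  by exists id.
by exists F; split=> [u /FP[]//|u t /FP[_ +] t01]; apply.
Qed.

End EdgeGraphs.

(** * The number of edges above a point *)

Section Rank.
Import Order.TTheory GRing.Theory Num.Theory numFieldNormedType.Exports.
Local Open Scope classical_set_scope.
Local Open Scope ring_scope.

Variables (R : realType) (n : nat) (d : diagram n) (D : drawing R d).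
Variable F : node n -> R -> R.
Hypothesis F_continuous : forall u, goes_right d u -> continuous (F u).
Hypothesis F_curve : forall u t, goes_right d u -> t \in `[0, 1] ->
  F u (curve D u t).1 = (curve D u t).2.
Implicit Types (u v : node n) (t x y : R) (p q : R * R) (i : 'I_n).

Local Notation node_x := (node_abscissa R).

Lemma graph_in_edges u x : goes_right d u -> in_range d u x -> edges D (x, F u x).
Proof.
move=> ru /(curve_fst_surj D ru)[t t01 tx]; exists u, t; split=> //.
by rewrite -tx F_curve //; case: (curve D u t).
Qed.

Lemma vertical_partner u : d u = (~~ u.1, u.2) <-> ~~ goes_right d u /\ ~~ goes_left d u.
Proof.
split=> [e|]; first by rewrite /goes_right /goes_left e ltnn.
by rewrite /goes_right /goes_left -!leqNgt => -[h1 h2]; apply: same_column; lia.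
Qed.

Lemma vertical_curve u t : d u = (~~ u.1, u.2) -> t \in `[0, 1] ->
  (curve D u t).1 = node_x u.2.
Proof.
move=> e t01; case: (curve_no_double_back D u) => [->//|inj].
have := inj 0 1 (@zero_in01 R) (@one_in01 R).
by rewrite /= curve_source curve_target e /= => /(_ erefl)/eqP; rewrite eq_sym oner_eq0.
Qed.

Lemma edges_cases p : edges D p ->
  (exists u, [/\ goes_right d u, in_range d u p.1 & p.2 = F u p.1]) \/
  (exists u, d u = (~~ u.1, u.2) /\ p.1 = node_x u.2).
Proof.
case=> u [t [t01 <-]]; case: (boolP (goes_right d u)) => [ru|nru].
  by left; exists u; rewrite F_curve //; split=> //; apply: curve_fst_range.
case: (boolP (goes_left d u)) => [lu|nlu]; last first.
  have e : d u = (~~ u.1, u.2) by apply/vertical_partner.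
  by right; exists u; rewrite vertical_curve.
have t01' : 1 - t \in `[0, 1] by move: t01; rewrite !in_itv /=; lra.
have ru : goes_right d (d u) by rewrite -goes_left_partner.
have -> : curve D u t = curve D (d u) (1 - t).
  by rewrite curve_rev // opprB addrC subrK.
by left; exists (d u); rewrite F_curve //; split=> //; apply: curve_fst_range.
Qed.

Lemma F_left u : goes_right d u -> F u (node_x u.2) = if u.1 then 1 else 0.
Proof.
by move=> ru; have := F_curve ru (@zero_in01 R); rewrite curve_source.
Qed.

Lemma F_right u : goes_right d u -> F u (node_x (d u).2) = if (d u).1 then 1 else 0.
Proof.
by move=> ru; have := F_curve ru (@one_in01 R); rewrite curve_target.
Qed.

Lemma F_interior u x : goes_right d u -> node_x u.2 < x < node_x (d u).2 ->
  0 < F u x < 1.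
Proof.
move=> ru /andP[ux xu].
have [|t t01 tx] := @curve_fst_surj _ _ _ D u x ru; first by rewrite /in_range !ltW.
have t01' : t \in `]0, 1[.
  move: t01; rewrite !in_itv /= !le_eqVlt => /andP[/orP[/eqP t0|->] /orP[/eqP t1|->]] //.
  - by move: t1; rewrite -t0 => /eqP; rewrite eq_sym oner_eq0.
  - by move: ux; rewrite -tx -t0 curve_source /= -/(node_x _) ltxx.
  - by move: xu; rewrite -tx t1 curve_target /= -/(node_x _) ltxx.
have [_ _ h1 h2] := curve_interior D u t01'.
by rewrite -tx F_curve // h1 h2.
Qed.

Lemma F_distinct u v x : goes_right d u -> goes_right d v -> in_range d u x ->
  in_range d v x -> u != v -> F u x <> F v x.
Proof.
move=> ru rv /(curve_fst_surj D ru)[s s01 sx] /(curve_fst_surj D rv)[t t01 tx] uv e.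
have vdu : v != d u.
  by apply: contraTneq rv => ->; rewrite -goes_left_partner goes_right_left.
have vu : v != u by rewrite eq_sym.
apply: (@curve_disjoint _ _ _ D u v vu vdu s t s01 t01).
apply: injective_projections; first by rewrite sx.
by rewrite -!F_curve // sx tx.
Qed.

Lemma vertical_edges u y : d u = (~~ u.1, u.2) -> 0 <= y <= 1 -> edges D (node_x u.2, y).
Proof.
move=> e y01.
have [t t01 ty] : exists2 t : R, t \in `[0, 1] & (curve D u t).2 = y.
  apply: (IVT ler01 (@curve_snd_continuous _ _ _ D u)).
  rewrite /= curve_source curve_target e /=.
  by case: ifP; rewrite /= ?(min_l ler01) ?(max_r ler01) ?(min_r ler01) ?(max_l ler01).
exists u, t; split=> //.
by rewrite -ty -(vertical_curve e t01); case: (curve D u t).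
Qed.

Lemma crosses_right k u : crosses d k u -> goes_right d u.
Proof. by case/andP => h1 h2; rewrite /goes_right (leq_ltn_trans h1). Qed.

Lemma crosses_range (k : nat) u x : crosses d k u -> node_x k <= x <= node_x k.+1 ->
  in_range d u x.
Proof.
case/andP => h1 h2 /andP[kx xk]; rewrite /in_range.
by rewrite (le_trans _ kx) ?node_abscissa_le // (le_trans xk) ?node_abscissa_le.
Qed.

Lemma crosses_interior (k : nat) u x : crosses d k u -> node_x k < x < node_x k.+1 ->
  0 < F u x < 1.
Proof.
move=> ku /andP[kx xk]; apply: F_interior; first exact: crosses_right ku.
case/andP: ku => h1 h2.
by rewrite (le_lt_trans _ kx) ?node_abscissa_le // (lt_le_trans xk) ?node_abscissa_le.
Qed.

Lemma column_edges i p : column i p ->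
  edges D p <-> exists2 u, crosses d i u & p.2 = F u p.1.
Proof.
move=> [ip pi p01]; split=> [/edges_cases[[u [ru /andP[u1 u2] pF]]|[u [_ e]]]|[u iu e]].
- exists u => //; apply/andP; split.
    have := le_lt_trans u1 pi; rewrite -[i.+2%:R]/(node_x i.+1) node_abscissa_lt.
    by rewrite ltnS.
  by have := lt_le_trans ip u2; rewrite -[i.+1%:R]/(node_x i) node_abscissa_lt.
- move: ip pi; rewrite e -[i.+2%:R]/(node_x i.+1) -[i.+1%:R]/(node_x i) !node_abscissa_lt.
  by rewrite ltnS => h1 h2; have := leq_trans h1 h2; rewrite ltnn.
have := graph_in_edges (crosses_right iu) (crosses_range iu (x := p.1) _).
by rewrite -e -surjective_pairing; apply; rewrite !ltW.
Qed.

(** [F u r.1 - r.2] has no zero on [C], since a zero would be a point of the edge, so its sign is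
    constant. *)
Lemma side_constant u (C : set (R * R)) : goes_right d u -> connected C ->
  (forall p, C p -> in_range d u p.1 /\ ~ edges D p) ->
  forall p q, C p -> C q -> p.2 < F u p.1 -> q.2 < F u q.1.
Proof.
move=> ru Cc Cp p q pC qC pF.
pose g r := F u r.1 - r.2 : R.
have cg : continuous g.
  move=> r; apply: cvgB; last exact: cvg_snd.
  by apply: continuous_comp; [exact: cvg_fst|exact: F_continuous].
have /connected_intervalP gI : connected (g @` C).
  by apply: connected_continuous_connected => //; exact: continuous_subspaceT.
rewrite ltNge; apply/negP => qF.
have [r rC /eqP] : (g @` C) 0.
  apply: (gI (g q) (g p)); [by exists q|by exists p|].
  by rewrite /g; move: pF qF; lra.
rewrite subr_eq0 => /eqP rF; have [rR] := Cp _ rC; apply.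
by have := graph_in_edges ru rR; rewrite rF -surjective_pairing.
Qed.

(* The number of edges of column i above p. *)
Definition column_rank i p : nat := (\sum_(u : node n) (crosses d i u && (p.2 < F u p.1)%R))%N.

(** The set may touch the node lines bounding the column; this is how ranks are carried to the line
    between two columns. *)
Lemma rank_constant i (C : set (R * R)) : connected C ->
  (forall p, C p -> node_x i <= p.1 <= node_x i.+1 /\ ~ edges D p) ->
  forall p q, C p -> C q -> column_rank i p = column_rank i q.
Proof.
move=> Cc Cp p q pC qC; apply: eq_bigr => u _; congr nat_of_bool.
case: (boolP (crosses d i u)) => //= iu.
have side := side_constant (crosses_right iu) Cc.
have {}side := side _; apply/idP/idP; apply: side => // r /Cp[r1 r2];
  by split=> //; apply: crosses_range r1.
Qed.

Lemma rank_le_width i p : (column_rank i p <= width d i)%N.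
Proof. by apply: leq_sum => u _; case: (crosses d i u) => //=; exact: leq_b1. Qed.

End Rank.

(** * Selecting a height or an index by rank *)

Section FiniteRanks.
Import Order.TTheory GRing.Theory Num.Theory.
Local Open Scope ring_scope.
Variables (R : realFieldType) (T : finType) (val : T -> R).

Let count_above (S : pred T) (P : pred T) u0 : S u0 ->
  (\sum_(u : T) (S u && P u) = P u0 + \sum_(u : T) ([&& S u, u != u0 & P u]))%N.
Proof.
move=> Su0; rewrite (bigD1 u0) //= Su0 [in RHS](bigD1 u0) //= eqxx andbF add0n.
by congr (_ + _)%N; apply: eq_bigr => u ->.
Qed.

Let max_exists (S : pred T) : (0 < \sum_(u : T) S u)%N ->
  exists2 u0, S u0 & forall u, S u -> val u <= val u0.
Proof.
move=> S0; have [u1 Su1] : exists u1, S u1.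
  case: (pickP S) => [u1|noS]; first by exists u1.
  by rewrite big1 // in S0 => u _; rewrite noS.
by case: (@arg_maxP _ _ _ u1 S val Su1) => u0 Su0 umax; exists u0.
Qed.

Let sum_remove (S : pred T) u0 : S u0 ->
  (\sum_(u : T) S u = (\sum_(u : T) (S u && (u != u0))).+1)%N.
Proof.
move=> Su0; rewrite -[RHS]add1n (bigD1 u0) //= Su0 [in RHS](bigD1 u0) //= eqxx andbF add0n.
by congr (_ + _)%N; apply: eq_bigr => u ->; rewrite andbT.
Qed.

(** The bound [b] varies in the induction: the largest value is removed from [S] and becomes the new
    bound. *)
Lemma exists_height_of_rank (S : pred T) (b : R) (r : nat) :
  0 < b -> {in S &, injective val} -> (forall u, S u -> 0 < val u < b) ->
  (r <= \sum_(u : T) S u)%N ->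
  exists y, [/\ 0 < y < b, forall u, S u -> val u <> y &
    (\sum_(u : T) (S u && (y < val u)%R) = r)%N].
Proof.
elim: r S b => [|r IHr] S b b0 inj range le_r.
  have [S0|/max_exists[u0 Su0 umax]] := posnP (\sum_(u : T) S u)%N.
    have noS u : S u = false.
      by apply/negbTE/negP => Su; move: S0; rewrite (sum_remove Su).
    exists (b / 2); split=> [|u|]; [lra|by rewrite noS|].
    by apply: big1 => u _; rewrite noS.
  have /andP[u00 u0b] := range _ Su0.
  exists ((val u0 + b) / 2); split=> [|u /umax ule e|]; [lra|lra|].
  by apply: big1 => u _; case: (boolP (S u)) => //= /umax ule; case: ltP => // h; exfalso; lra.
have /max_exists[u0 Su0 umax] : (0 < \sum_(u : T) S u)%N by exact: leq_trans le_r.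
have /andP[u00 u0b] := range _ Su0.
have strict u : S u && (u != u0) -> 0 < val u < val u0.
  move=> /andP[Su une]; have /andP[-> _] := range u Su.
  by rewrite lt_neqAle umax // andbT /=; apply: contra une => /eqP/inj->.
have [||||y [/andP[y0 yu] yne yr]] := IHr [pred u | S u && (u != u0)] (val u0).
- by [].
- by move=> u v /andP[Su _] /andP[Sv _]; apply: inj.
- exact: strict.
- by move: le_r; rewrite (sum_remove Su0).
exists y; split=> [|u Su|].
- by rewrite y0 (lt_trans yu).
- by have [->|une] := eqVneq u u0; [lra|apply: yne; rewrite /= Su].
by rewrite (count_above _ Su0) yu -yr; congr (_.+1); apply: eq_bigr => u _; rewrite /= andbA.
Qed.

Lemma exists_index_of_rank (S : pred T) (r : nat) : {in S &, injective val} ->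
  (r < \sum_(u : T) S u)%N ->
  exists2 u, S u & (\sum_(v : T) (S v && (val u < val v)%R) = r)%N.
Proof.
elim: r S => [|r IHr] S inj lt_r.
  have [u0 Su0 umax] := max_exists lt_r; exists u0 => //.
  by apply: big1 => u _; case: (boolP (S u)) => //= /umax ule; case: ltP => // h; exfalso; lra.
have [u0 Su0 umax] := max_exists (leq_trans (ltn0Sn _) lt_r).
have [||u /andP[Su une] ur] := IHr [pred u | S u && (u != u0)].
- by move=> u v /andP[Su _] /andP[Sv _]; apply: inj.
- by move: lt_r; rewrite (sum_remove Su0).
exists u => //; rewrite (count_above _ Su0) -ur lt_neqAle umax // andbT.
have -> : val u != val u0 by apply: contra une => /eqP/inj->.
by congr (_.+1); apply: eq_bigr => v _; rewrite /= andbA.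
Qed.

End FiniteRanks.

(** * Points of a column with a given rank *)

Section LevelSets.
Import Order.TTheory GRing.Theory Num.Theory numFieldNormedType.Exports.
Local Open Scope classical_set_scope.
Local Open Scope ring_scope.

Lemma continuous_bigmin (R : realType) (T : topologicalType) (I : Type) (s : seq I)
    (P : pred I) (G : I -> T -> R) (b : R) : (forall i, P i -> continuous (G i)) ->
  continuous (fun x => \big[Num.min/b]_(i <- s | P i) G i x).
Proof.
move=> cG; elim: s => [|i s IHs].
  by under eq_fun do rewrite big_nil; move=> x; exact: cvg_cst.
under eq_fun do rewrite big_cons; case: (boolP (P i)) => // Pi x.
exact: (@continuous_min R T (G i) _ x (cG i Pi x) (IHs x)).
Qed.

Lemma continuous_bigmax (R : realType) (T : topologicalType) (I : Type) (s : seq I)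
    (P : pred I) (G : I -> T -> R) (b : R) : (forall i, P i -> continuous (G i)) ->
  continuous (fun x => \big[Num.max/b]_(i <- s | P i) G i x).
Proof.
move=> cG; elim: s => [|i s IHs].
  by under eq_fun do rewrite big_nil; move=> x; exact: cvg_cst.
under eq_fun do rewrite big_cons; case: (boolP (P i)) => // Pi x.
exact: (@continuous_max R T (G i) _ x (cG i Pi x) (IHs x)).
Qed.

Variables (R : realType) (n : nat) (d : diagram n) (D : drawing R d).
Variable F : node n -> R -> R.
Hypothesis F_continuous : forall u, goes_right d u -> continuous (F u).
Hypothesis F_curve : forall u t, goes_right d u -> t \in `[0, 1] ->
  F u (curve D u t).1 = (curve D u t).2.
Implicit Types (u v : node n) (t x y : R) (p q : R * R) (i : 'I_n).

Local Notation node_x := (node_abscissa R).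
Local Notation rank := (column_rank d F).

Lemma column_range i p : column i p -> node_x i < p.1 < node_x i.+1.
Proof. by case=> h1 h2 _; apply/andP. Qed.

(** This is why the mere number of edges above a point determines which edges they are. *)
Lemma crosses_order i u v x x' : crosses d i u -> crosses d i v ->
  node_x i < x < node_x i.+1 -> node_x i < x' < node_x i.+1 ->
  F u x < F v x -> F u x' < F v x'.
Proof.
move=> iu iv ix ix' lt_x.
have uv : u != v by apply: contraTneq lt_x => ->; rewrite ltxx.
pose g z := F v z - F u z : R.
have cg : continuous g.
  by move=> z; apply: cvgB; apply: F_continuous; [exact: crosses_right iv|exact: crosses_right iu].
pose C := [set z : R | node_x i < z < node_x i.+1].
have /connected_intervalP gI : connected (g @` C).
  apply: connected_continuous_connected; last exact: continuous_subspaceT.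
  apply/connected_intervalP => a b; rewrite /C /= => ia ib z; lra.
rewrite ltNge; apply/negP => le_x'.
have [z zC /eqP] : (g @` C) 0.
  apply: (gI (g x') (g x)); [by exists x'|by exists x|].
  by rewrite /g; move: lt_x le_x'; lra.
have zr : node_x i <= z <= node_x i.+1 by case/andP: zC => h1 h2; rewrite !ltW.
rewrite subr_eq0 eq_sym => /eqP.
apply: (F_distinct F_curve (crosses_right iu) (crosses_right iv)) => //;
  exact: crosses_range zr.
Qed.

(** An edge above [q] is above [u] there, hence above [u] over the whole column, hence above [p].
    The edge [u] itself counts only for [p]. *)
Lemma rank_lt i p q u : column i p -> column i q -> ~ edges D p ->
  crosses d i u -> p.2 < F u p.1 -> F u q.1 <= q.2 -> (rank i q < rank i p)%N.
Proof.
move=> ip iq ep iu up uq; rewrite /column_rank.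
rewrite (bigD1 u) //= [in X in (_ < X)%N](bigD1 u) //= iu up ltNge uq /= add0n add1n ltnS.
apply: leq_sum => v _; case: (boolP (crosses d i v)) => //= iv.
case: (boolP (q.2 < F v q.1)) => // vq; rewrite lt0b.
have := @crosses_order i u v q.1 p.1 iu iv (column_range iq) (column_range ip).
by move=> /(_ (le_lt_trans uq vq)); apply: lt_trans.
Qed.

Lemma rank_eq_sides i p q u : column i p -> column i q -> ~ edges D p -> ~ edges D q ->
  rank i p = rank i q -> crosses d i u -> (p.2 < F u p.1) = (q.2 < F u q.1).
Proof.
move=> ip iq ep eq e iu; apply/idP/idP => h; rewrite ltNge; apply/negP => h'.
  by have := rank_lt ip iq ep iu h h'; rewrite e ltnn.
by have := rank_lt iq ip eq iu h h'; rewrite e ltnn.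
Qed.

Definition level_set i (r : nat) : set (R * R) :=
  [set p | [/\ column i p, ~ edges D p & rank i p = r]].

Lemma off_edges i p : column i p -> ~ edges D p ->
  forall u, crosses d i u -> p.2 <> F u p.1.
Proof. by move=> ip ep u iu e; apply: ep; apply/(column_edges F_curve ip); exists u. Qed.

(* The graph of the interpolation below runs through p and stays between the
   same edges as p. *)
Lemma level_section i p : column i p -> ~ edges D p ->
  exists phi : R -> R, [/\ continuous phi, phi p.1 = p.2 &
    forall x, node_x i < x < node_x i.+1 -> 0 <= phi x <= 1 /\
      forall u, crosses d i u ->
        (p.2 < F u p.1 -> phi x < F u x) /\ (F u p.1 < p.2 -> F u x < phi x)].
Proof.
move=> ip ep; have pr := column_range ip; have [_ _ p01] := ip.
pose up x : R := \big[Num.min/1]_(u | crosses d i u && (p.2 < F u p.1)) F u x.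
pose lo x : R := \big[Num.max/0]_(u | crosses d i u && (F u p.1 < p.2)) F u x.
have lo_up x : node_x i < x < node_x i.+1 -> lo x < up x.
  move=> ix; apply: bigmax_lt => [|u /andP[iu ul]].
    apply: lt_bigmin => [|u /andP[iu _]]; first exact: ltr01.
    by case/andP: (crosses_interior F_curve iu ix).
  apply: lt_bigmin => [|v /andP[iv vu]].
    by case/andP: (crosses_interior F_curve iu ix).
  exact: (crosses_order iu iv pr ix (lt_trans ul vu)).
have cup : continuous up.
  by apply: continuous_bigmin => u /andP[/crosses_right/F_continuous].
have clo : continuous lo.
  by apply: continuous_bigmax => u /andP[/crosses_right/F_continuous].
have lo_le x u : crosses d i u -> F u p.1 < p.2 -> F u x <= lo x.
  by move=> iu ul; apply: (@le_bigmax_cond _ _ _ _ u _ (fun u => F u x)); rewrite iu.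
have up_ge x u : crosses d i u -> p.2 < F u p.1 -> up x <= F u x.
  by move=> iu ul; apply: (@bigmin_le_cond _ _ _ _ u _ (fun u => F u x)); rewrite iu.
have lo0 x : 0 <= lo x by exact: bigmax_ge_id.
have up1 x : up x <= 1 by exact: bigmin_le_id.
have lo_p : lo p.1 <= p.2.
  by case/andP: p01 => p0 _; apply: bigmax_le => // u /andP[_ /ltW].
have up_p : p.2 <= up p.1.
  by case/andP: p01 => _ p1; apply: le_bigmin => // u /andP[_ /ltW].
have lo_up_p := lo_up _ pr.
(* [l] is the relative height of [p] between the nearest edges above and below, replaced by the
   faces where there are none. It is 0 or 1 only if [p] lies on a face, and then no edge lies on
   that side of [p]. *)
pose l := (p.2 - lo p.1) / (up p.1 - lo p.1).
have den : 0 < up p.1 - lo p.1 by lra.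
have l0 : 0 <= l by apply: divr_ge0; lra.
have l1 : l <= 1 by rewrite ler_pdivrMr //; lra.
exists (fun x => lo x + l * (up x - lo x)); split.
- move=> x; apply: cvgD; first exact: clo.
  by apply: cvgM; [exact: cvg_cst|apply: cvgB; [exact: cup|exact: clo]].
- by rewrite /l divfK; [lra|lra].
move=> x ix; have lux := lo_up x ix; have := lo0 x; have := up1 x => u1x l0x.
split; first by nra.
move=> u iu; split=> [pu|up'].
  have lt1 : l < 1.
    rewrite ltr_pdivrMr // mul1r ltrD2r; apply: lt_bigmin => [|v /andP[] //].
    by case/andP: (crosses_interior F_curve iu pr) => _; apply: lt_trans.
  by apply: lt_le_trans (up_ge x u iu pu); nra.
have lt0 : 0 < l.
  apply: divr_gt0 => //; rewrite subr_gt0; apply: bigmax_lt => [|v /andP[] //].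
  by case/andP: (crosses_interior F_curve iu pr) => h _; apply: lt_trans up'.
by apply: le_lt_trans (lo_le x u iu up') _; nra.
Qed.

End LevelSets.

(** * Regions, vertical adjacency and labels in terms of ranks *)

Section RegionRanks.
Import Order.TTheory GRing.Theory Num.Theory numFieldNormedType.Exports.
Local Open Scope classical_set_scope.
Local Open Scope ring_scope.

Lemma continuous_into_prod (T U V : topologicalType) (f : T -> U) (g : T -> V) :
  continuous f -> continuous g -> continuous (fun x => (f x, g x)).
Proof. by move=> cf cg x; exact: (cvg_pair (cf x) (cg x)). Qed.

Variables (R : realType) (n : nat) (d : diagram n) (D : drawing R d).
Variable F : node n -> R -> R.
Hypothesis F_continuous : forall u, goes_right d u -> continuous (F u).
Hypothesis F_curve : forall u t, goes_right d u -> t \in `[0, 1] ->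
  F u (curve D u t).1 = (curve D u t).2.
Implicit Types (u v : node n) (t x y : R) (p q : R * R) (i : 'I_n) (r : nat).

Local Notation node_x := (node_abscissa R).
Local Notation rank := (column_rank d F).
Local Notation level_set := (level_set D F).

Lemma same_sides_level i p q : column i p -> ~ edges D p -> column i q ->
  (forall u, crosses d i u ->
    (p.2 < F u p.1 -> q.2 < F u q.1) /\ (F u p.1 < p.2 -> F u q.1 < q.2)) ->
  level_set i (rank i p) q.
Proof.
move=> ip ep iq sides.
have pne := off_edges F_curve ip ep.
have side u : crosses d i u -> p.2 < F u p.1 \/ F u p.1 < p.2.
  by move=> /pne/eqP; rewrite neq_lt => /orP.
split=> //.
  move=> /(column_edges F_curve iq)[u iu e]; have [s1 s2] := sides u iu.
  by case: (side u iu) => [/s1|/s2]; rewrite e ltxx.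
apply: eq_bigr => u _; congr nat_of_bool; case: (boolP (crosses d i u)) => //= iu.
have [s1 s2] := sides u iu; case: (side u iu) => h.
  by rewrite h s1.
by rewrite !ltNge (ltW h) (ltW (s2 h)).
Qed.

Lemma component_level i p : column i p -> ~ edges D p ->
  connected_component (column i `\` edges D) p = level_set i (rank i p).
Proof.
move=> ip ep; have Ap : (column i `\` edges D) p by split.
have pne := off_edges F_curve ip ep; have pr := column_range ip.
apply/seteqP; split=> [q pq|q [iq eq rq]].
  have [iq eq] := connected_component_sub pq; split=> //.
  apply: (rank_constant F_continuous F_curve
    (component_connected (A := column i `\` edges D) (x := p))) => //.
    move=> r /connected_component_sub[ir er]; split=> //.
    by have /andP[h1 h2] := column_range ir; rewrite !ltW.
  exact: connected_component_refl.
have qr := column_range iq.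
have [phi [cphi phip phiP]] := level_section F_continuous F_curve ip ep.
have sides u : crosses d i u ->
    (p.2 < F u p.1 -> q.2 < F u q.1) /\ (F u p.1 < p.2 -> F u q.1 < q.2).
  move=> iu; rewrite (rank_eq_sides F_continuous F_curve ip iq ep eq (esym rq) iu).
  split=> // h; have := rank_eq_sides F_continuous F_curve ip iq ep eq (esym rq) iu.
  rewrite (ltNge p.2) (ltW h) /= => /esym/negbT; rewrite -leNgt le_eqVlt => /orP[/eqP e|//].
  by case: (off_edges F_curve iq eq iu).
(* A path from [p] to [q] in two pieces: the section through [p] along the column, then the vertical
   segment from this section to [q]. Both stay on the same side of every edge as [p]. *)
pose C1 := (fun x => (x, phi x)) @` [set x : R | node_x i < x < node_x i.+1].
pose C2 := (fun y => (q.1, y)) @`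
  [set y : R | Num.min (phi q.1) q.2 <= y <= Num.max (phi q.1) q.2].
have C1A : C1 `<=` column i `\` edges D.
  move=> _ [x ix <-]; have [x01 xs] := phiP _ ix.
  have ixy : column i (x, phi x) by case/andP: ix => h1 h2; split.
  by have [_ ? _] := same_sides_level ip ep ixy xs.
have C2A : C2 `<=` column i `\` edges D.
  move=> _ [y yr <-]; have [q01 qs] := phiP _ qr.
  have iqy : column i (q.1, y).
    case: iq => h1 h2 q2; split=> //=; move: yr q01 q2 => /=.
    by rewrite ge_min le_max => /andP[/orP[] a1 /orP[] a2] /andP[b1 b2] /andP[b3 b4];
      apply/andP; split; lra.
  have [] // := same_sides_level ip ep iqy _.
  move=> u iu /=; have [a1 a2] := sides u iu; have [b1 b2] := qs u iu.
  move: yr; rewrite /= ge_min le_max => /andP[c1 c2]; split=> [pu|pu].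
    by case/orP: c2 => c2; [have := b1 pu|have := a1 pu]; lra.
  by case/orP: c1 => c1; [have := b2 pu|have := a2 pu]; lra.
have C1c : connected C1.
  apply: connected_continuous_connected.
    by apply/connected_intervalP => a b /= ia ib z; lra.
  apply: continuous_subspaceT; apply: continuous_into_prod cphi.
  by move=> x; exact: cvg_id.
have C2c : connected C2.
  apply: connected_continuous_connected.
    apply/connected_intervalP => a b /= /andP[ia _] /andP[_ ib] z /andP[za zb].
    by rewrite (le_trans ia) //= (le_trans zb).
  apply: continuous_subspaceT; apply: continuous_into_prod => x; [exact: cvg_cst|exact: cvg_id].
have C12 : connected (C1 `|` C2).
  apply: connectedU => //; exists (q.1, phi q.1); split; first by exists q.1.
  by exists (phi q.1) => //=; rewrite ge_min lexx le_max lexx.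
apply: (connected_component_max _ _ C12).
- by left; exists p.1 => //; rewrite phip; case: (p).
- by move=> z [/C1A|/C2A].
- right; exists q.2; last by case: (q).
  by rewrite /= ge_min lexx orbT le_max lexx orbT.
Qed.

Lemma F_inj_on i x : node_x i < x < node_x i.+1 ->
  {in crosses d i &, injective (fun u => F u x)}.
Proof.
move=> /andP[h1 h2] u v iu iv e; apply/eqP/negPn/negP => uv.
have ix : node_x i <= x <= node_x i.+1 by rewrite !ltW.
exact: (F_distinct F_curve (crosses_right iu) (crosses_right iv)
  (crosses_range iu ix) (crosses_range iv ix) uv e).
Qed.

Lemma level_point i x r : node_x i < x < node_x i.+1 -> (r <= width d i)%N ->
  exists y, level_set i r (x, y).
Proof.
move=> ix ri.
have [|y [/andP[y0 y1] yne yr]] :=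
  exists_height_of_rank (b := 1) (@ltr01 R) (F_inj_on ix) _ ri.
  by move=> u iu; exact: (crosses_interior F_curve iu ix).
have iy : column i (x, y) by case/andP: ix => h1 h2; split; rewrite //= !ltW.
exists y; split=> //.
by move/(column_edges F_curve iy) => [u iu /esym]; exact: yne.
Qed.

Definition mid i : R := node_x i + 2^-1.

Lemma mid_range i : node_x i < mid i < node_x i.+1.
Proof. by rewrite /mid /node_abscissa -[i.+2%:R]natr1; lra. Qed.

Lemma level_inj i r s : (r <= width d i)%N -> level_set i r = level_set i s -> r = s.
Proof.
move=> /(level_point (mid_range i))[y yr] e; have [_ _ <-] := yr.
by move: yr; rewrite e => -[].
Qed.

Lemma region_level i A : region D i A <-> exists2 r, (r <= width d i)%N & A = level_set i r.
Proof.
split=> [[p [ip ep] ->]|[r ri ->]].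
  by exists (rank i p); [exact: rank_le_width|exact: component_level].
have [y [iy ey er]] := level_point (mid_range i) ri.
by exists (mid i, y); [split|rewrite component_level // er].
Qed.

(** Near a point of the edge [u] only the side of [u] can change, so at most two ranks occur
    there. *)
Lemma near_edge i p u : column i p -> crosses d i u -> p.2 = F u p.1 ->
  \forall q \near p, column i q /\ forall v, crosses d i v -> v != u ->
    (p.2 < F v p.1 -> q.2 < F v q.1) /\ (F v p.1 < p.2 -> F v q.1 < q.2).
Proof.
move=> ip iu pu; have pr := column_range ip.
have nbhs_p : Filter (nbhs p) by exact: nbhs_filter.
have cfst : (fun q : R * R => q.1) @ p --> p.1 by exact: cvg_fst.
have csnd : (fun q : R * R => q.2) @ p --> p.2 by exact: cvg_snd.
have /andP[p0 p1] : 0 < p.2 < 1 by rewrite pu; exact: (crosses_interior F_curve iu pr).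
have /andP[ipl ipr] := pr.
have near_col : \forall q \near p, column i q.
  have n1 : \forall q \near p, node_x i < q.1 by exact: cvgr_gt cfst _ ipl.
  have n2 : \forall q \near p, q.1 < node_x i.+1 by exact: cvgr_lt cfst _ ipr.
  have n3 : \forall q \near p, 0 < q.2 by exact: cvgr_gt csnd _ p0.
  have n4 : \forall q \near p, q.2 < 1 by exact: cvgr_lt csnd _ p1.
  apply: filterS (filterI n1 (filterI n2 (filterI n3 n4))) => q [h1 [h2 [h3 h4]]].
  by split; rewrite // !ltW.
have near_v : \forall q \near p, forall v, crosses d i v -> v != u ->
    (p.2 < F v p.1 -> q.2 < F v q.1) /\ (F v p.1 < p.2 -> F v q.1 < q.2).
  apply: (filter_forall nbhs_p) => v.
  case: (boolP (crosses d i v)) => iv; last by apply: filterE.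
  pose g (q : R * R) := F v q.1 - q.2 : R.
  have cg : g @ p --> g p.
    apply: cvgB; last exact: csnd.
    by apply: continuous_comp; [exact: cfst|apply: F_continuous; exact: (crosses_right iv)].
  case: (ltgtP p.2 (F v p.1)) => pv.
  - have gp : 0 < g p by rewrite subr_gt0.
    have : \forall q \near p, 0 < g q by exact: cvgr_gt cg _ gp.
    apply: filterS => q; rewrite subr_gt0 => h _ _.
    by split=> //; rewrite ltNge (ltW pv).
  - have gp : g p < 0 by rewrite subr_lt0.
    have : \forall q \near p, g q < 0 by exact: cvgr_lt cg _ gp.
    apply: filterS => q; rewrite subr_lt0 => h _ _.
    by split=> //; rewrite ltNge (ltW pv).
  - apply: filterE => q _ vu; case/eqP: vu; apply: (F_inj_on pr) => //.
    by rewrite -pu pv.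
exact: filterI.
Qed.

Lemma level_near_edge i p q u : column i p -> crosses d i u -> p.2 = F u p.1 ->
  column i q -> (forall v, crosses d i v -> v != u ->
    (p.2 < F v p.1 -> q.2 < F v q.1) /\ (F v p.1 < p.2 -> F v q.1 < q.2)) ->
  rank i q = (rank i p + (q.2 < F u q.1)%R)%N /\ (q.2 <> F u q.1 -> ~ edges D q).
Proof.
move=> ip iu pu iq sides; have pr := column_range ip.
have pne v : crosses d i v -> v != u -> p.2 < F v p.1 \/ F v p.1 < p.2.
  move=> iv vu; apply/orP; rewrite -neq_lt; apply: contra vu => /eqP e.
  by apply/eqP/(F_inj_on pr) => //; rewrite -e.
split.
  rewrite addnC /rank /column_rank (bigD1 u) //= [in RHS](bigD1 u) //= iu.
  rewrite [in (p.2 < _)]pu ltxx add0n; congr (_ + _)%N; apply: eq_bigr => v vu.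
  congr nat_of_bool; case: (boolP (crosses d i v)) => //= iv.
  have [s1 s2] := sides v iv vu; case: (pne v iv vu) => h; first by rewrite h s1.
  by rewrite !ltNge (ltW h) (ltW (s2 h)).
move=> qu /(column_edges F_curve iq)[v iv e].
have vu : v != u by apply/eqP => vu; apply: qu; rewrite -vu.
have [s1 s2] := sides v iv vu.
by case: (pne v iv vu) => [/s1|/s2]; rewrite e ltxx.
Qed.

Lemma vert_adjacent_rank i r s : vert_adjacent D i (level_set i r) (level_set i s) ->
  s = r.+1 \/ r = s.+1.
Proof.
move=> [_ _ rs [p [ip ep]]]; have [u iu pu] := (column_edges F_curve ip).1 ep.
have near_p := near_edge ip iu pu.
have rank_cases a : closure (level_set i a) p -> a = rank i p \/ a = (rank i p).+1.
  move=> /(_ _ near_p)[q [[iq eq <-] [_ sides]]].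
  have [-> _] := level_near_edge ip iu pu iq sides.
  by case: (_ < _); [right|left]; rewrite ?addn1 ?addn0.
move=> /rank_cases rp /rank_cases sp.
have : r <> s by move=> e; apply: rs; rewrite e.
by case: rp sp => -> [] ->; [|left|right|].
Qed.

Lemma vert_adjacent_next i r : (r < width d i)%N ->
  vert_adjacent D i (level_set i r) (level_set i r.+1).
Proof.
move=> ri; have mr := mid_range i; have /andP[m1 m2] := mr.
(* [u] has exactly [r] edges above it on the middle line, so the points just above and just below it
   have ranks [r] and [r.+1]. *)
have [u iu ur] := exists_index_of_rank (F_inj_on mr) ri.
pose p : R * R := (mid i, F u (mid i)).
have /andP[p0 p1] := crosses_interior F_curve iu mr.
have ip : column i p by split; rewrite //= !ltW.
have rp : rank i p = r by rewrite -ur; apply: eq_bigr.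
split; [by apply/region_level; exists r => //; exact: ltnW|
  by apply/region_level; exists r.+1| |].
  by move/(level_inj (ltnW ri))/eqP; rewrite ltn_eqF.
have near_u B : nbhs p B -> exists2 e : R, 0 < e & forall y, `|F u (mid i) - y| < e ->
    B (mid i, y) /\ (column i (mid i, y) /\
      forall v, crosses d i v -> v != u -> (p.2 < F v p.1 -> y < F v (mid i)) /\
        (F v p.1 < p.2 -> F v (mid i) < y)).
  move=> Bp; have near_p := near_edge ip iu erefl.
  have cc : continuous (fun y : R => (mid i, y)).
    by apply: continuous_into_prod => x; [exact: cvg_cst|exact: cvg_id].
  have : nbhs (F u (mid i)) ((fun y => (mid i, y)) @^-1` (B `&` _)) :=
    cc (F u (mid i)) _ (@filterI _ _ (nbhs_filter p) _ _ Bp near_p).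
  move=> /nbhs_ballP[e e0 eB].
  by exists e => // y /eB.
exists p; split=> //.
- by apply/(column_edges F_curve ip); exists u.
- move=> B /near_u[e e0 eB].
  have [|Bq [iq sides]] := eB (F u (mid i) + e / 2).
    by rewrite opprD addrA subrr sub0r normrN gtr0_norm; lra.
  exists (mid i, F u (mid i) + e / 2); split=> //.
  have [rq eq] := level_near_edge ip iu erefl iq sides.
  split=> //; first by apply: eq => /=; lra.
  by rewrite rq rp /= ltNge (_ : F u (mid i) <= _) ?addn0 //; lra.
- move=> B /near_u[e e0 eB].
  have [|Bq [iq sides]] := eB (F u (mid i) - e / 2).
    by rewrite opprB addrC subrK gtr0_norm; lra.
  exists (mid i, F u (mid i) - e / 2); split=> //.
  have [rq eq] := level_near_edge ip iu erefl iq sides.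
  split=> //; first by apply: eq => /=; lra.
  by rewrite rq rp /= (_ : F u (mid i) - e / 2 < F u (mid i)) ?addn1 //; lra.
Qed.

(** [lies_below] compares points on a common vertical line only. It is not vacuous here, as the
    middle line meets every level. *)
Lemma lies_below_rank i r s : (r <= width d i)%N -> (s <= width d i)%N ->
  lies_below (level_set i s) (level_set i r) -> (r <= s)%N.
Proof.
move=> ri si below; have [y yr] := level_point (mid_range i) ri.
have [z zs] := level_point (mid_range i) si.
have /ltW zy := below _ _ _ zs yr.
have [_ _ <-] := yr; have [_ _ <-] := zs.
apply: leq_sum => u _; case: (crosses d i u) => //=.
by case: (boolP (y < F u (mid i))) => // /(le_lt_trans zy) ->.
Qed.

Lemma lies_below_next i r s : (r < s)%N -> lies_below (level_set i s) (level_set i r).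
Proof.
move=> rs x y z [_ _ ys] [_ _ zr]; rewrite ltNge; apply/negP => zy.
move: rs; rewrite -ys -zr ltnNge; apply/negP; rewrite negbK.
apply: leq_sum => u _; case: (crosses d i u) => //=.
by case: (boolP (y < F u x)) => // /(le_lt_trans zy) ->.
Qed.

Lemma vert_below i r T : (r <= width d i)%N ->
  (vert_adjacent D i (level_set i r) T /\ lies_below T (level_set i r)) <->
  ((r < width d i)%N /\ T = level_set i r.+1).
Proof.
move=> ri; split=> [[adj below]|[ri' ->]]; last first.
  by split; [exact: vert_adjacent_next|exact: lies_below_next].
have [_ /region_level[s si e] _ _] := adj; subst T.
have := lies_below_rank ri si below.
case: (vert_adjacent_rank adj) => [e|->]; last by rewrite ltnn.
by rewrite e in si *.
Qed.

Lemma region_labelP i A b : region_label D i A b <->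
  exists2 r, (r <= width d i)%N & A = level_set i r /\ b = odd r.
Proof.
split=> [|[r ri [-> ->]] {A b}].
  elim=> {A b} [A /region_level[r ri ->] [x [ip ep er]]|A B b _ [r ri [-> ->]] adj below].
    exists 0%N => //; suff -> : r = 0%N by [].
    rewrite -er; apply: big1 => u _; case: (boolP (crosses d i u)) => //= iu.
    have /andP[_ u1] := crosses_interior F_curve iu (column_range ip).
    by rewrite ltNge ltW.
  have [ri' ->] := (vert_below B ri).1 (conj adj below).
  by exists r.+1.
elim: r ri => [|r IHr] ri.
  apply: LabelNorth; first by apply/region_level; exists 0%N.
  exists (mid i); have /andP[m1 m2] := mid_range i.
  have ip : column i (mid i, 1) by split; rewrite //= ?ler01 ?lexx.
  have below u : crosses d i u -> F u (mid i) < 1.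
    by move=> iu; case/andP: (crosses_interior F_curve iu (mid_range i)).
  split=> //.
    by move/(column_edges F_curve ip) => [u /below + /= e]; rewrite -e ltxx.
  apply: big1 => u _; case: (boolP (crosses d i u)) => //= /below /ltW.
  by rewrite ltNge => ->.
have [adj below] := (vert_below (level_set i r.+1) (ltnW ri)).2 (conj ri erefl).
exact: LabelNext (IHr (ltnW ri)) adj below.
Qed.

End RegionRanks.

(** * Passing from one column to the next *)

Section Gaps.
Import Order.TTheory GRing.Theory Num.Theory numFieldNormedType.Exports.
Local Open Scope classical_set_scope.
Local Open Scope ring_scope.

Variables (R : realType) (n : nat) (d : diagram n) (D : drawing R d).
Variable F : node n -> R -> R.
Hypothesis F_continuous : forall u, goes_right d u -> continuous (F u).
Hypothesis F_curve : forall u t, goes_right d u -> t \in `[0, 1] ->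
  F u (curve D u t).1 = (curve D u t).2.
Implicit Types (u v : node n) (t x y : R) (p q : R * R) (i j : 'I_n) (r s : nat).

Local Notation node_x := (node_abscissa R).
Local Notation rank := (column_rank d F).
Local Notation level_set := (level_set D F).

Definition passes (k : nat) u := (u.2 < k < (d u).2)%N.

Definition gap_rank (k : nat) y : nat :=
  (\sum_(u : node n) (passes k u && (y < F u (node_x k))%R))%N.

Lemma width_left_passes (k : nat) : (k < n)%N ->
  (width d k = \sum_(u : node n) passes k.+1 u +
     (goes_left d (north n k.+1) + goes_left d (south n k.+1)))%N.
Proof.
move=> kn; rewrite -(sum_node_at (goes_left d) kn).
rewrite [X in (_ + X)%N](reindex_inj (inv_inj (partnerK d))) -big_split.
by apply: eq_bigr => u _; rewrite /crosses /passes /goes_left /= partnerK; lia.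
Qed.

Lemma width_right_passes (k : nat) : (k <= n)%N ->
  (width d k = \sum_(u : node n) passes k u +
     (goes_right d (north n k) + goes_right d (south n k)))%N.
Proof.
move=> kn; rewrite -(sum_node_at (goes_right d) kn) -big_split.
by apply: eq_bigr => u _; rewrite /crosses /passes /goes_right /=; lia.
Qed.

(** On the node line, the edges of column [i] are those passing through and those ending there. An
    end at the north node is above every [y < 1]; an end at the south node is above no [y > 0]. *)
Lemma rank_left_gap i y : 0 < y < 1 ->
  rank i (node_x i.+1, y) = (gap_rank i.+1 y + goes_left d (north n i.+1))%N.
Proof.
move=> /andP[y0 y1]; have hi := ltn_ord i.
have -> : (goes_left d (north n i.+1) : nat) =
    (\sum_(u : node n) ((u == d (north n i.+1)) && goes_left d (north n i.+1)))%N.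
  rewrite (bigD1 (d (north n i.+1))) //= eqxx big1 ?addn0 // => u /negbTE->.
  by [].
rewrite -big_split; apply: eq_bigr => u _ /=; rewrite /passes /crosses ltnS.
have [du|du] := (d u).2 =P i.+1 :> nat; last first.
  have -> : (u == d (north n i.+1)) = false.
    by apply/negP => /eqP e; apply: du; rewrite e partnerK north2.
  by rewrite addn0; congr nat_of_bool; congr (_ && _); lia.
rewrite du ltnn andbF add0n ltnS leqnn andbT.
case: (leqP u.2 i) => ui /=; last first.
  apply/esym/eqP; rewrite eqb0; apply/negP => /andP[/eqP e].
  by rewrite /goes_left -e north2 //; move: ui; rewrite ltnNge -ltnS => /negbTE->.
have ru : goes_right d u by rewrite /goes_right du ltnS.
have -> : F u (node_x i.+1) = if (d u).1 then 1 else 0 by rewrite -du; exact: (F_right F_curve ru).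
have [e|e] := node_at du.
  have -> : u = d (north n i.+1) by rewrite -e partnerK.
  by rewrite partnerK eqxx /= y1 /goes_left -e partnerK e north2 // ltnS ui.
rewrite e /= ltNge (ltW y0) /=; apply/esym/eqP; rewrite eqb0.
by apply/negP => /andP[/eqP eu _]; move: e; rewrite eu partnerK.
Qed.

Lemma rank_right_gap i y : 0 < y < 1 ->
  rank i (node_x i, y) = (gap_rank i y + goes_right d (north n i))%N.
Proof.
move=> /andP[y0 y1]; have hi := ltn_ord i; have hi' := ltnW hi.
have -> : (goes_right d (north n i) : nat) =
    (\sum_(u : node n) ((u == north n i) && goes_right d (north n i)))%N.
  rewrite (bigD1 (north n i)) //= eqxx big1 ?addn0 // => u /negbTE->.
  by [].
rewrite -big_split; apply: eq_bigr => u _ /=; rewrite /passes /crosses.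
have [ui|ui] := u.2 =P i :> nat; last first.
  have -> : (u == north n i) = false.
    by apply/negP => /eqP e; apply: ui; rewrite e north2.
  have -> : (u.2 < i)%N = (u.2 <= i)%N by rewrite ltn_neqAle; case: eqP ui.
  by rewrite addn0.
rewrite ui ltnn leqnn /= add0n.
case: (boolP (goes_right d u)) => ru; last first.
  have -> : (i < (d u).2)%N = false by apply/negbTE; rewrite -ui.
  by apply/esym/eqP; rewrite eqb0; apply: contra ru => /andP[/eqP-> ->].
have -> : F u (node_x i) = if u.1 then 1 else 0 by rewrite -ui; exact: (F_left F_curve ru).
have -> : (i < (d u).2)%N = true by move: ru; rewrite /goes_right ui.
have [e|e] := node_at ui; first by rewrite -e eqxx ru /= e y1.
have -> : (u == north n i) = false by rewrite e xpair_eqE.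
by rewrite e /= ltNge (ltW y0).
Qed.

Lemma node_edges u : edges D (node_x u.2, if u.1 then 1 else 0).
Proof. by exists u, 0; split; [exact: zero_in01|rewrite curve_source]. Qed.

Lemma vertical_line_edges (k : nat) y : (k <= n)%N -> d (north n k) = south n k ->
  0 <= y <= 1 -> edges D (node_x k, y).
Proof.
move=> kn e y01; have v : d (north n k) = (~~ (north n k).1, (north n k).2) by rewrite e.
by have := vertical_edges D v y01; rewrite north2.
Qed.

Lemma off_edges_open (k : nat) y : (k <= n)%N -> 0 <= y <= 1 -> ~ edges D (node_x k, y) ->
  0 < y < 1.
Proof.
move=> kn /andP[y0 y1] ey; rewrite !lt_neqAle y0 y1 !andbT.
apply/andP; split; apply/eqP => e; apply: ey.
  by have := node_edges (south n k); rewrite south2 // -e.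
by have := node_edges (north n k); rewrite north2 // e.
Qed.

Lemma segment_continuous p q : continuous (fun t => segment_pt p q t).
Proof.
apply: continuous_into_prod => t; apply: cvgD; apply: cvgM; try exact: cvg_cst;
  try exact: cvg_id; apply: cvgB; try exact: cvg_cst; exact: cvg_id.
Qed.

Lemma segment_ranks i j p q : i.+1 = j :> nat -> column i p -> column j q ->
  (forall t, t \in `[0, 1] -> ~ edges D (segment_pt p q t)) ->
  exists t, let y := (segment_pt p q t).2 in
    [/\ 0 < y < 1, ~ edges D (node_x j, y),
      rank i p = (gap_rank j y + goes_left d (north n j))%N &
      rank j q = (gap_rank j y + goes_right d (north n j))%N].
Proof.
move=> ij ip jq seg; have hj := ltn_ord j.
have [ip1 ip2 /andP[p0 p1]] := ip; have [jq1 jq2 /andP[q0 q1]] := jq.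
have ix : node_x i.+1 = node_x j by rewrite ij.
have {ip1} ip1 : node_x i < p.1 by [].
have {ip2} ip2 : p.1 < node_x j by rewrite -ix.
have {jq1} jq1 : node_x j < q.1 by [].
have {jq2} jq2 : q.1 < node_x j.+1 by [].
(* At [t0] the segment meets the node line. The rank of column [i] is constant up to this point and
   that of column [j] from it on, and both are expressed there by [gap_rank]. *)
pose t0 := (node_x j - p.1) / (q.1 - p.1).
have den : 0 < q.1 - p.1 by lra.
have t00 : 0 <= t0 by apply: divr_ge0; lra.
have t01 : t0 <= 1 by rewrite ler_pdivrMr //; lra.
have t0E : t0 * (q.1 - p.1) = node_x j - p.1 by rewrite /t0 divfK // gt_eqF.
have seg_t0 : segment_pt p q t0 = (node_x j, (segment_pt p q t0).2).
  by rewrite /segment_pt /=; congr (_, _); lra.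
have ey : ~ edges D (node_x j, (segment_pt p q t0).2).
  by rewrite -seg_t0; apply: seg; rewrite in_itv /= t00 t01.
have y01 : 0 < (segment_pt p q t0).2 < 1.
  by apply: (off_edges_open (ltnW hj)) ey; rewrite /segment_pt /=; nra.
have seg0 : segment_pt p q 0 = p by rewrite /segment_pt subr0 !mul1r !mul0r !addr0; case: (p).
have seg1 : segment_pt p q 1 = q by rewrite /segment_pt subrr !mul1r !mul0r !add0r; case: (q).
have conn (a b : R) : connected (segment_pt p q @` [set t | a <= t <= b]).
  apply: connected_continuous_connected; last exact: continuous_subspaceT (@segment_continuous p q).
  by apply/connected_intervalP => x y /= /andP[ax _] /andP[_ yb] z /andP[xz zy];
    rewrite (le_trans ax) //= (le_trans zy).
exists t0; split=> //.
  rewrite -ij -rank_left_gap // ix -seg_t0.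
  apply: (rank_constant F_continuous F_curve (conn 0 t0)).
  - move=> _ [t /andP[ta tb] <-]; split; last first.
      by apply: seg; rewrite in_itv /= ta (le_trans tb).
    by rewrite ix /segment_pt /=; nra.
  - by exists 0; rewrite /= ?lexx ?t00.
  - by exists t0; rewrite /= ?lexx ?t00.
rewrite -rank_right_gap // -seg_t0.
apply: (rank_constant F_continuous F_curve (conn t0 1)).
- move=> _ [t /andP[ta tb] <-]; split; last first.
    by apply: seg; rewrite in_itv /= tb (le_trans t00).
  by rewrite /segment_pt /=; nra.
- by exists 1; rewrite /= ?lexx ?t01.
- by exists t0; rewrite /= ?lexx ?t01.
Qed.

End Gaps.

(** [r - gl] is the number of passing edges above the wanted gap. It could exceed their total [m]
    only for the two bottom regions, of even ranks [wi] and [wj], while [r] or [s] is odd. *)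
Lemma gap_arith (r s m wi wj : nat) (gl gr sl sr : bool) :
  gr + gl = 1 -> r + gr = s + gl -> wi = m + (gl + sl) -> wj = m + (gr + sr) ->
  ~~ odd wi -> ~~ odd wj -> r <= wi -> s <= wj -> odd r || odd s ->
  [/\ r - gl + gl = r, r - gl + gr = s & r - gl <= m].
Proof. by case: gl gr sl sr => -[] [] [] //= *; split; lia. Qed.

(** * Horizontal adjacency and the region graph *)

Section RegionGraph.
Import Order.TTheory GRing.Theory Num.Theory numFieldNormedType.Exports.
Local Open Scope classical_set_scope.
Local Open Scope ring_scope.

Variables (R : realType) (n : nat) (d : diagram n) (D : drawing R d).

Lemma edges_closed : closed (edges D).
Proof.
have -> : edges D = \bigcup_(u in [set: node n]) (curve D u @` `[0, 1]).
  apply/seteqP; split=> [p [u [t [t01 <-]]]|p [u _ [t t01 <-]]].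
    by exists u => //; exists t.
  by exists u, t.
apply: closed_bigcup; first exact: finite_finset.
move=> u _; apply: compact_closed; first exact: norm_hausdorff.
by apply: continuous_compact; [exact: curve_continuous|exact: segment_compact].
Qed.

Lemma segment_pt_sym (p q : R * R) (t : R) : segment_pt q p t = segment_pt p q (1 - t).
Proof. by rewrite /segment_pt; congr (_, _); ring. Qed.

Lemma horiz_adjacent_sym i A j B : horiz_adjacent D i A j B -> horiz_adjacent D j B i A.
Proof.
move=> [ij iA jB [p [q [Ap Bq seg]]]]; split=> //.
  by move: ij; rewrite /neighbors orbC.
exists q, p; split=> // t t01; rewrite segment_pt_sym; apply: seg.
by move: t01; rewrite !in_itv /=; lra.
Qed.

Variable F : node n -> R -> R.
Hypothesis F_continuous : forall u, goes_right d u -> continuous (F u).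
Hypothesis F_curve : forall u t, goes_right d u -> t \in `[0, 1] ->
  F u (curve D u t).1 = (curve D u t).2.
Implicit Types (u v : node n) (t x y : R) (p q : R * R) (i j : 'I_n) (r s : nat).

Local Notation node_x := (node_abscissa R).
Local Notation level_set := (level_set D F).

Lemma gap_point (k : nat) (g : nat) : (k <= n)%N -> d (north n k) <> south n k ->
  (g <= \sum_(u : node n) passes d k u)%N ->
  exists y, [/\ 0 < y < 1, ~ edges D (node_x k, y) & gap_rank d F k y = g].
Proof.
move=> kn nv gm.
have pass_right u : passes d k u -> goes_right d u.
  by case/andP=> h1 h2; exact: ltn_trans h1 h2.
have pass_range u : passes d k u -> node_x u.2 < node_x k < node_x (d u).2.
  by rewrite !node_abscissa_lt.
have inj : {in passes d k &, injective (fun u => F u (node_x k))}.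
  move=> u v iu iv e; apply/eqP/negPn/negP => uv.
  have /andP[u1 u2] := pass_range u iu; have /andP[v1 v2] := pass_range v iv.
  by apply: (F_distinct F_curve (pass_right u iu) (pass_right v iv) _ _ uv e);
    rewrite /in_range !ltW.
have [|y [y01 yne yr]] := exists_height_of_rank (b := 1) (@ltr01 R) inj _ gm.
  by move=> u iu; apply: (F_interior F_curve (pass_right u iu)); exact: pass_range.
exists y; split=> //.
have /andP[y0 y1] := y01.
case/(edges_cases F_curve) => [[u [ru /= /andP[]]]|[u [e /= uk]]]; last first.
  have {}uk : u.2 = k :> nat.
    by apply/eqP; move/eqP: uk; rewrite eqr_nat eqSS eq_sym.
  case: (node_at uk) => eu; rewrite eu in e; apply: nv; first exact: e.
  by rewrite -[RHS](partnerK d) e.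
rewrite !node_abscissa_le => u1 u2 yF.
have [uk|uk] := u.2 =P k :> nat.
  by move: yF y0 y1; rewrite -uk (F_left F_curve ru) => ->; case: ifP => _; lra.
have [duk|duk] := (d u).2 =P k :> nat.
  by move: yF y0 y1; rewrite -duk (F_right F_curve ru) => ->; case: ifP => _; lra.
by apply: (yne u _ (esym yF)); rewrite /passes; move: u1 u2 uk duk; lia.
Qed.

(** A segment between the columns meets the node line in a gap, whose rank is [r] less the left
    contribution of the north edge and [s] less the right one. Conversely, a gap of that rank exists
    and is crossed by a short horizontal segment, as the edges form a closed set. *)
Lemma horiz_adjacentP i j r s : i.+1 = j :> nat -> (r <= width d i)%N ->
  (s <= width d j)%N -> odd r || odd s ->
  horiz_adjacent D i (level_set i r) j (level_set j s) <->
  d (north n j) <> south n j /\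
  (r + goes_right d (north n j) = s + goes_left d (north n j))%N.
Proof.
move=> ij ri sj rs; have hj := ltn_ord j; have hi := ltn_ord i; have hj' := ltnW hj.
have ij_nb : neighbors i j by rewrite /neighbors ij eqxx.
have regA : region D i (level_set i r) by apply/(region_level F_continuous F_curve); exists r.
have regB : region D j (level_set j s) by apply/(region_level F_continuous F_curve); exists s.
split=> [[_ _ _ [p [q [[ip ep <-] [jq eq <-] seg]]]]|[nv e]].
  have [t [/andP[y0 y1] ey -> ->]] := segment_ranks F_continuous F_curve ij ip jq seg.
  split; last by rewrite -!addnA [(goes_left _ _ + _)%N]addnC.
  by move=> v; apply: ey; apply: (vertical_line_edges _ hj' v); rewrite !ltW.
have wl := width_left_passes d hi; rewrite ij in wl.
have wr := width_right_passes d hj'.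
have even_i := width_even d (ltnW hi); have even_j := width_even d hj'.
have nv' : (d (north n j) == south n j) = false by apply/eqP.
have one : (goes_right d (north n j) + goes_left d (north n j))%N = 1%N.
  have := partner_north d hj'; rewrite nv'.
  have := @goes_right_left _ d (north n j).
  by case: (goes_right d _) => [/(_ isT)/negbTE->|_] //; case: (goes_left d _).
have [gr gs gm] := gap_arith one e wl wr even_i even_j ri sj rs.
have [y [y01 ey yg]] := gap_point hj' nv gm.
have [/andP[y0 y1] ix] : 0 < y < 1 /\ node_x i.+1 = node_x j by rewrite ij.
have [e0 /= e0_gt0 e0B] : exists2 e0 : R, 0 < e0 & forall q, ball (node_x j, y) e0 q -> ~ edges D q.
  have : nbhs (node_x j, y) (~` edges D).
    by apply: open_nbhs_nbhs; split=> //; apply: closed_openC; exact: edges_closed.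
  by move=> /nbhs_ballP[e0 e0_gt0 h]; exists e0.
(* Half of [e0] keeps the segment in the ball avoiding the edges; one half keeps its ends inside the
   two columns, which have breadth 1. *)
pose a := Num.min (e0 / 2) 2^-1.
have a0 : 0 < a by rewrite lt_min; apply/andP; split; lra.
have ae : a < e0 by rewrite gt_min; apply/orP; left; lra.
have a1 : a < 1 by rewrite gt_min; apply/orP; right; lra.
have nxi : node_x j = node_x i + 1 by rewrite -ix /node_abscissa -natr1.
have nxj : node_x j.+1 = node_x j + 1 by rewrite /node_abscissa -[j.+2%:R]natr1.
pose p := (node_x j - a, y); pose q := (node_x j + a, y).
have ip : column i p by split; rewrite /= -?[i.+1%:R]/(node_x i) -?[i.+2%:R]/(node_x i.+1) ?ix; lra.
have jq : column j q by split; rewrite /= -?[j.+1%:R]/(node_x j) -?[j.+2%:R]/(node_x j.+1); lra.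
have seg t : t \in `[0, 1] -> ~ edges D (segment_pt p q t).
  rewrite in_itv /= => /andP[t0 t1]; apply: e0B; rewrite /ball /=; split; rewrite /ball /=.
    by rewrite ltr_norml; apply/andP; split; nra.
  by rewrite (_ : y - _ = 0) ?normr0 //; ring.
have [t [_ _ rp rq]] := segment_ranks F_continuous F_curve ij ip jq seg.
have yt : (segment_pt p q t).2 = y by rewrite /segment_pt /=; ring.
rewrite yt yg in rp rq.
split=> //; exists p, q; split=> //.
  split=> //; last by rewrite rp.
  by have := seg 0 (@zero_in01 R); rewrite /segment_pt /= subr0 !mul1r !mul0r !addr0.
split=> //; last by rewrite rq.
by have := seg 1 (@one_in01 R); rewrite /segment_pt /= subrr !mul1r !mul0r !add0r.
Qed.

Lemma one_region_level (v : one_region D) : exists t : nat,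
  (t < height d (sval v).1)%N /\ (sval v).2 = level_set (sval v).1 t.*2.+1.
Proof.
case: v => -[i A] /= /(region_labelP F_continuous F_curve)[r ri [-> r_odd]].
exists r./2; have rE : r = r./2.*2.+1 by rewrite -{1}[r]odd_double_half -r_odd.
by split; [move: ri; rewrite height_width; lia|rewrite -rE].
Qed.

Lemma not_vertical i j (t s : nat) : i.+1 = j :> nat -> (t < height d i)%N -> (s < height d j)%N ->
  d (north n j) <> south n j.
Proof.
move=> ij ti sj v; have := partner_vertical_width (ltnW (ltn_ord j)) v.
by rewrite !height_width => -[h _]; move: sj; lia.
Qed.

(** Even widths guarantee a region of rank [t.*2.+2] below the 1-region of rank [t.*2.+1]. Its
    adjacency to rank [s.*2.+1], when [j] is the column to the right, reads
    [t.*2.+2 + gr = s.*2.+1 + gl] with [gl = ~~ gr], that is [s = t + gr]. *)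
Lemma region_arrow_level i j (t s : nat) : (t < height d i)%N -> (s < height d j)%N ->
  (exists T, [/\ vert_adjacent D i (level_set i t.*2.+1) T,
     lies_below T (level_set i t.*2.+1) & horiz_adjacent D i T j (level_set j s.*2.+1)]) <->
  coord_arrow d i t j s.
Proof.
move=> ti sj.
have ti1 : (t.*2.+1 < width d i)%N by rewrite height_width; lia.
have sj1 : (s.*2.+1 <= width d j)%N by rewrite height_width; lia.
have odd1 : odd t.*2.+2 || odd s.*2.+1 by rewrite /= !odd_double.
have odd2 : odd s.*2.+1 || odd t.*2.+2 by rewrite /= !odd_double.
have dir (k : 'I_n) : d (north n k) <> south n k ->
    goes_left d (north n k) = ~~ goes_right d (north n k).
  move=> nv; have := partner_north d (ltnW (ltn_ord k)); have := @goes_right_left _ d (north n k).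
  have -> : (d (north n k) == south n k) = false by apply/eqP.
  by case: (goes_right d _) => [/(_ isT)/negbTE->|_] //; case: (goes_left d _).
have -> : (exists T, [/\ vert_adjacent D i (level_set i t.*2.+1) T,
     lies_below T (level_set i t.*2.+1) & horiz_adjacent D i T j (level_set j s.*2.+1)]) <->
   horiz_adjacent D i (level_set i t.*2.+2) j (level_set j s.*2.+1).
  split=> [[T [a b h]]|h].
    by have [_ e] := (vert_below F_continuous F_curve T (ltnW ti1)).1 (conj a b); rewrite -e.
  have [a b] := (vert_below F_continuous F_curve (level_set i t.*2.+2) (ltnW ti1)).2
    (conj ti1 erefl).
  by exists (level_set i t.*2.+2).
split=> [h|[[ij e]|[ji e]]].
- have [/orP[/eqP ij|/eqP ji] _ _ _] := h.
    left; split=> //; have nv := not_vertical ij ti sj.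
    have [_] := (horiz_adjacentP ij ti1 sj1 odd1).1 h.
    by rewrite dir //; case: (goes_right d _) => /=; lia.
  right; split=> //; have nv := not_vertical ji sj ti.
  have [_] := (horiz_adjacentP ji sj1 ti1 odd2).1 (horiz_adjacent_sym h).
  by rewrite dir //; case: (goes_right d _) => /=; lia.
- have nv := not_vertical ij ti sj.
  apply/(horiz_adjacentP ij ti1 sj1 odd1).
  by split=> //; rewrite e dir //; case: (goes_right d _) => /=; lia.
- have nv := not_vertical ji sj ti; apply: horiz_adjacent_sym.
  apply/(horiz_adjacentP ji sj1 ti1 odd2).
  by split=> //; rewrite e dir //; case: (goes_right d _) => /=; lia.
Qed.

Lemma region_graph_coordinatized :
  exists lev, @coordinatized n d (region_graph D) lev.
Proof.
have [lev levP] := choice one_region_level.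
exists lev; split.
- move=> u v /= uv lev_uv; have [_ eu] := levP u; have [_ ev] := levP v.
  apply: eq_sig_hprop => [x h h'|]; first exact: Prop_irrelevance.
  apply: injective_projections => //.
  by rewrite eu ev uv lev_uv.
- by move=> u; have [] := levP u.
- move=> i t ti.
  have ti1 : (t.*2.+1 <= width d i)%N by rewrite height_width; lia.
  have lab : region_label D i (level_set i t.*2.+1) true.
    apply/(region_labelP F_continuous F_curve); exists t.*2.+1 => //.
    by rewrite /= odd_double.
  pose v : one_region D := exist _ (i, level_set i t.*2.+1) lab.
  exists v; split=> //; have [vh ve] := levP v; move: ve => /= ve.
  by have := level_inj F_curve ti1 ve; lia.
- move=> u v; have [uh ue] := levP u; have [vh ve] := levP v.
  rewrite /= -(region_arrow_level uh vh) -ue -ve /region_arrow.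
  by case: (sval u) => i A; case: (sval v).
Qed.

End RegionGraph.

Theorem theorem4p7 (R : realType) (n : nat) (hn : (1 <= n)%N) (d : diagram n) :
  exists w : coxA n,
    [/\ fully_commutative w,
        (forall x : word n, reduced_expr w x -> word_diagram x = dbasis d)
      & (forall (D : drawing R d) (x : word n), reduced_expr w x ->
           ldigraph_iso (region_graph D) (heap_hasse x))].
Proof.
have [x0 rx0] := realizes_exists d; exists (word_elt x0).
(* Realization is invariant under commutations, so it passes from [x0] to every reduced word of its
   element. *)
have realizes_red x : reduced_expr (word_elt x0) x -> realizes d x.
  by move=> /(realizes_reduced rx0)/(realizes_comm d)/iffLR; exact.
split=> [|x /realizes_red|D x /realizes_red rx].
- exact: realizes_fully_commutative rx0.
- exact: word_diagram_realizes.
have [F [F_continuous F_curve]] := edge_graphs_exist D.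
have [lev levP] := region_graph_coordinatized F_continuous F_curve.
exact: coordinatized_iso levP (heap_coordinatized rx).
Qed.
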